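(* There is an absolute constant $c>0$ for which the following is true. Let $t\in\mathbb{N}$, $N \ge 1$, and let $D \subseteq [N]^3$ be a nonempty set that is $(c\sqrt{t}, \frac{t}{c})$-evasive with respect to slice functions. Then for any cylinder intersection $F$ on $[N]^3$ with $\mathbb{E}_{(x,y,z)\sim[N]^3}[F(x,y,z)] \le 2^{-t}$, it holds that $$\mathbb{E}_{(x,y,z)\sim D}[F(x,y,z)] \le 2^{-\Omega(\sqrt{t})},$$ where the implied constant is absolute.
   Context: A cylinder intersection on $[N]^3$ is a function $F(x,y,z) = f(x,y)g(x,z)h(y,z)$ with $f,g,h$ $\{0,1\}$-valued. A slice function on $[N]^3$ is an indicator function of one of the forms $g(x,y)h(z)$, $g(x)h(y,z)$, or $g(x,z)h(y)$ with $g,h$ $\{0,1\}$-valued. A set $D$ is $(k,d')$-evasive (w.r.t. slice functions) if for every slice function $s$ with $\mathbb{E}_{w\sim[N]^3}[s(w)] \ge 2^{-d'}$ we have $\mathbb{E}_{w\sim D}[s(w)] \le 2^{k}\mathbb{E}_{w\sim [N]^3}[s(w)]$, where $w\sim D$ and $w\sim[N]^3$ denote uniform distributions. *)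

(* Defs.v *)
From mathcomp Require Import all_boot all_order all_algebra.
From mathcomp Require Import reals exp.

Set Implicit Arguments.
Unset Strict Implicit.
Unset Printing Implicit Defensive.

Import Order.TTheory GRing.Theory Num.Theory.
Local Open Scope ring_scope.

Definition cube (N : nat) : finType := ('I_N * 'I_N * 'I_N)%type.

(* Expectation of the {0,1}-valued function [f] under the uniform distribution
   on [D]; only meaningful for nonempty [D] (division by 0 yields 0). *)
Definition expect (R : realType) (T : finType) (D : {set T}) (f : T -> bool)
    : R :=
  (\sum_(w in D) (f w)%:R) / #|D|%:R.
Arguments expect R {T} D f.

Definition cylinder_intersection (N : nat) (F : cube N -> bool) : Prop :=
  exists f g h : 'I_N -> 'I_N -> bool,
    forall x y z : 'I_N, F (x, y, z) = [&& f x y, g x z & h y z].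

Definition slice_function (N : nat) (s : cube N -> bool) : Prop :=
  [\/ exists (g : 'I_N -> 'I_N -> bool) (h : 'I_N -> bool),
        forall x y z : 'I_N, s (x, y, z) = g x y && h z,
      exists (g : 'I_N -> bool) (h : 'I_N -> 'I_N -> bool),
        forall x y z : 'I_N, s (x, y, z) = g x && h y z
    | exists (g : 'I_N -> 'I_N -> bool) (h : 'I_N -> bool),
        forall x y z : 'I_N, s (x, y, z) = g x z && h y].

Definition evasive (R : realType) (N : nat) (k d : R) (D : {set cube N})
    : Prop :=
  forall s : cube N -> bool, slice_function s ->
    2 `^ (- d) <= expect R [set: cube N] s ->
    expect R D s <= 2 `^ k * expect R [set: cube N] s.

(* Main.v *)
(** Suppose that [F] has weight at least 2^(-n) under [D], with n ~ sqrt t, and let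
    [E] be the part of [D] inside [F].  Among all boxes that are not too small
    choose one maximising (density of [E])^M * (volume), with M ~ n.  As
    evasiveness bounds the density of [E] on slices, this box has volume at least
    2^(-O(nM)), and inside it no subbox of comparable volume is much denser.  Let
    [G(x,z)] and [H(y,z)] be the marginals on the box of the normalised indicator
    of [E]; truncate them and normalise every row to mean 1.  If the correlation
    [E_z G(x,z) H(y,z)] is at most 1/8, then [E_z (G-1)(H-1) <= -7/8].  Few pairs
    [(x,y)] in the first factor of [F] have a larger correlation, since [F] has
    density only 2^(-t), whereas that factor has density at least 2^(-O(n)) even
    after the rows damaged by the truncation are removed.  So a high even moment of
    [E_z (G-1)(H-1)] is large, and by Cauchy-Schwarz so is a moment of
    [E_z G(x,z) G(x',z)] or of its analogue for [H].  Fixing [x], the level sets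
    of this function of [x'] then provide a rectangle on which [G] is too dense. *)

Require Import Defs.
From mathcomp Require Import all_boot all_order all_algebra.
From mathcomp Require Import reals exp.
From mathcomp Require Import lra ring zify.

Set Implicit Arguments.
Unset Strict Implicit.
Unset Printing Implicit Defensive.

Import Order.TTheory GRing.Theory Num.Theory.
Local Open Scope ring_scope.

(** * Weighted means *)

Definition mean (R : pzSemiRingType) (T : finType) (p F : T -> R) : R :=
  \sum_t p t * F t.

Notation "\E_ ( x ~ p ) F" := (mean p (fun x => F))
  (at level 0, F at level 41, x name, p at level 99,
   format "'[' \E_ ( x  ~  p ) '/  '  F ']'") : ring_scope.

Section Mean.
Variables (R : realFieldType) (T : finType).
Implicit Types (p F G : T -> R) (k : R).

Lemma eq_mean p F G : (forall x, F x = G x) -> \E_(x ~ p) F x = \E_(x ~ p) G x.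
Proof. by move=> FG; apply: eq_bigr => x _; rewrite FG. Qed.

Lemma meanD p F G : \E_(x ~ p) (F x + G x) = \E_(x ~ p) F x + \E_(x ~ p) G x.
Proof. by rewrite -big_split; apply: eq_bigr => x _; rewrite mulrDr. Qed.

Lemma meanZ p k F : \E_(x ~ p) (k * F x) = k * \E_(x ~ p) F x.
Proof. by rewrite mulr_sumr; apply: eq_bigr => x _; rewrite mulrCA. Qed.

Lemma meanZr p k F : \E_(x ~ p) (F x * k) = (\E_(x ~ p) F x) * k.
Proof. by rewrite mulr_suml; apply: eq_bigr => x _; rewrite mulrA. Qed.

Lemma meanB p F G : \E_(x ~ p) (F x - G x) = \E_(x ~ p) F x - \E_(x ~ p) G x.
Proof.
rewrite -[- mean p G]mulN1r -meanZ -meanD.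
by apply: eq_mean => x; rewrite mulN1r.
Qed.

Lemma mean_sum (I : finType) p (F : I -> T -> R) :
  \E_(x ~ p) (\sum_i F i x) = \sum_i \E_(x ~ p) F i x.
Proof.
by rewrite exchange_big; apply: eq_bigr => x _; rewrite mulr_sumr.
Qed.

Lemma mean_eq0 p F : (forall x, F x = 0) -> \E_(x ~ p) F x = 0.
Proof. by move=> F0; apply: big1 => x _; rewrite F0 mulr0. Qed.

Lemma mean_cst p k : \sum_x p x = 1 -> \E_(x ~ p) k = k.
Proof. by move=> p1; rewrite /mean -mulr_suml p1 mul1r. Qed.

Lemma ler_mean p F G :
  (forall x, 0 <= p x) -> (forall x, F x <= G x) ->
  \E_(x ~ p) F x <= \E_(x ~ p) G x.
Proof. by move=> p0 FG; apply: ler_sum => x _; rewrite ler_wpM2l. Qed.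

Lemma mean_ge0 p F :
  (forall x, 0 <= p x) -> (forall x, 0 <= F x) -> 0 <= \E_(x ~ p) F x.
Proof. by move=> p0 F0; apply: sumr_ge0 => x _; rewrite mulr_ge0. Qed.

Lemma mean_le p F k :
  (forall x, 0 <= p x) -> \sum_x p x <= 1 -> 0 <= k ->
  (forall x, F x <= k) -> \E_(x ~ p) F x <= k.
Proof.
move=> p0 p1 k0 Fk; apply: (@le_trans _ _ (\E_(x ~ p) k)); first exact: ler_mean.
by rewrite /mean -mulr_suml ler_piMl.
Qed.

Lemma mean_neqE p F x :
  \E_(y ~ p) ((y != x)%:R * F y) = \E_(y ~ p) F y - p x * F x.
Proof.
rewrite /mean [X in _ = X - _](bigD1 x) //= addrAC subrr add0r.
by rewrite [RHS]big_mkcond; apply: eq_bigr => y _; case: eqP => _;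
  rewrite ?mul0r ?mulr0 ?mul1r.
Qed.

End Mean.

Lemma exchange_mean (R : realFieldType) (X Y : finType) (u : X -> R) (v : Y -> R)
    (F : X -> Y -> R) :
  \E_(x ~ u) \E_(y ~ v) F x y = \E_(y ~ v) \E_(x ~ u) F x y.
Proof.
rewrite [RHS]mean_sum; apply: eq_bigr => x _ /=.
by rewrite -meanZ; apply: eq_bigr => y _; rewrite mulrCA.
Qed.

(** * Moments of correlations *)

Section Correlation.
Variables (R : realFieldType) (Z : finType) (w : Z -> R).

Definition corr (X Y : Type) (a : X -> Z -> R) (b : Y -> Z -> R) (x : X) (y : Y) : R :=
  \E_(z ~ w) (a x z * b y z).

Definition centre (X : Type) (g : X -> Z -> R) (x : X) (z : Z) : R := g x z - 1.

Lemma corr_centre (X Y : Type) (g : X -> Z -> R) (h : Y -> Z -> R) x y :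
  \sum_z w z = 1 -> \E_(z ~ w) g x z = 1 -> \E_(z ~ w) h y z = 1 ->
  corr (centre g) (centre h) x y = corr g h x y - 1.
Proof.
move=> w1 g1 h1; rewrite /corr.
rewrite (@eq_mean _ _ _ _ (fun z => g x z * h y z + 1 - (g x z + h y z))).
  by rewrite meanB !meanD g1 h1 mean_cst //; ring.
by move=> z; rewrite /centre; ring.
Qed.

Lemma mean_corrX (X Y : finType) (u : X -> R) (v : Y -> R)
    (a : X -> Z -> R) (b : Y -> Z -> R) n :
  \E_(x ~ u) \E_(y ~ v) corr a b x y ^+ n =
  \sum_(f : {ffun 'I_n -> Z}) (\prod_i w (f i)) *
    ((\E_(x ~ u) \prod_i a x (f i)) * (\E_(y ~ v) \prod_i b y (f i))).
Proof.
have corrXE x y : corr a b x y ^+ n = \sum_(f : {ffun 'I_n -> Z})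
    (\prod_i w (f i)) * ((\prod_i a x (f i)) * \prod_i b y (f i)).
  rewrite -[in LHS](card_ord n) -prodr_const.
  rewrite (bigA_distr_bigA (fun _ z => w z * (a x z * b y z))) /=.
  by apply: eq_bigr => f _; rewrite !big_split.
under eq_mean do under eq_mean do rewrite corrXE.
under eq_mean do rewrite mean_sum.
rewrite mean_sum; apply: eq_bigr => f _.
by under eq_mean do rewrite !meanZ; rewrite meanZ meanZr.
Qed.

Hypothesis w_ge0 : forall z, 0 <= w z.

Lemma mean_corrX_ge0 (X : finType) (u : X -> R) (a : X -> Z -> R) n :
  0 <= \E_(x ~ u) \E_(x' ~ u) corr a a x x' ^+ n.
Proof.
rewrite mean_corrX; apply: sumr_ge0 => f _.
by rewrite mulr_ge0 ?prodr_ge0 // -expr2 sqr_ge0.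
Qed.

Lemma mean_corrX_le (X Y : finType) (u : X -> R) (v : Y -> R)
    (a : X -> Z -> R) (b : Y -> Z -> R) n :
  2 * \E_(x ~ u) \E_(y ~ v) corr a b x y ^+ n <=
  \E_(x ~ u) \E_(x' ~ u) corr a a x x' ^+ n +
  \E_(y ~ v) \E_(y' ~ v) corr b b y y' ^+ n.
Proof.
rewrite !mean_corrX -big_split mulr_sumr ler_sum // => f _ /=.
set s := \E_(x ~ u) _; set t := \E_(y ~ v) _.
rewrite -mulrDr mulrCA; apply: ler_wpM2l; first by rewrite prodr_ge0.
by have := sqr_ge0 (s - t); rewrite -subr_ge0; lra.
Qed.

End Correlation.

Lemma leq_exp2_bin n : (2 ^ n <= 'C(n.*2, n))%N.
Proof.
elim: n => [|n IHn]; first by rewrite bin0.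
have symm : 'C(n.*2.+1, n.+1) = 'C(n.*2.+1, n).
  by rewrite -bin_sub; [congr 'C(_, _); lia|lia].
rewrite doubleS binS symm expnS mul2n -addnn.
by rewrite leq_add // (leq_trans IHn) // leq_bin2l.
Qed.

(* Expanding [corr g g = 1 + corr (centre g) (centre g)] and keeping one term is
   allowed because all moments of the centred correlation are nonnegative. *)
Lemma mean_corrX_centre_le (R : realFieldType) (X Z : finType)
    (u : X -> R) (w : Z -> R) (g : X -> Z -> R) n :
  (forall z, 0 <= w z) -> \sum_z w z = 1 -> (forall x, \E_(z ~ w) g x z = 1) ->
  2 ^+ n * \E_(x ~ u) \E_(x' ~ u) corr w (centre g) (centre g) x x' ^+ n <=
  \E_(x ~ u) \E_(x' ~ u) corr w g g x x' ^+ n.*2.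
Proof.
move=> w0 w1 g1; set K := corr w (centre g) (centre g).
have expand x x' :
    corr w g g x x' ^+ n.*2 = \sum_(i < n.*2.+1) 'C(n.*2, i)%:R * K x x' ^+ i.
  rewrite -[corr _ _ _ _ _](subrK 1) -corr_centre // addrC exprDn.
  by apply: eq_bigr => i _; rewrite expr1n mul1r -mulr_natl.
have -> : \E_(x ~ u) \E_(x' ~ u) corr w g g x x' ^+ n.*2 =
    \sum_(i < n.*2.+1) 'C(n.*2, i)%:R * \E_(x ~ u) \E_(x' ~ u) K x x' ^+ i.
  under eq_mean do under eq_mean do rewrite expand.
  under eq_mean do rewrite mean_sum.
  rewrite mean_sum; apply: eq_bigr => i _.
  by under eq_mean do rewrite meanZ; rewrite meanZ.
have lt_n : (n < n.*2.+1)%N by lia.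
rewrite (bigD1 (Ordinal lt_n)) //= -[leLHS]addr0 lerD //.
  by rewrite ler_wpM2r ?mean_corrX_ge0 // -natrX ler_nat leq_exp2_bin.
by apply: sumr_ge0 => i _; rewrite mulr_ge0 ?mean_corrX_ge0.
Qed.

(** * Functions without dense rectangles *)

Section DyadicMoment.
Variable R : realFieldType.

Lemma exprn_le_dyadic_sum (W th : R) n J :
  0 <= th -> 0 <= W -> W <= 2 ^+ J * th ->
  W ^+ n <= th ^+ n + \sum_(j < J) (2 ^+ j.+1 * th) ^+ n * (2 ^+ j * th <= W)%R%:R.
Proof.
move=> th0 W0; elim: J => [|J IHJ] WJ.
  by rewrite big_ord0 addr0 lerXn2r ?nnegrE //; rewrite mul1r in WJ.
have pow_ge0 j : 0 <= (2 ^+ j * th) ^+ n by rewrite exprn_ge0 // mulr_ge0 // exprn_ge0.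
rewrite big_ord_recr /= addrA; have [lt_WJ|_] := ltP W (2 ^+ J * th).
  by rewrite mulr0 addr0 IHJ // ltW.
rewrite mulr1 -[leLHS]add0r lerD ?lerXn2r ?nnegrE //.
  rewrite addr_ge0 ?exprn_ge0 // sumr_ge0 // => j _; exact: mulr_ge0.
by rewrite mulr_ge0 // exprn_ge0.
Qed.

Lemma sum_halves_le J : \sum_(j < J) 2 ^- j <= 2 :> R.
Proof.
suff -> : \sum_(j < J) 2 ^- j = 2 - 2 * 2 ^- J :> R.
  by rewrite gerBl mulr_ge0 // invr_ge0 exprn_ge0.
elim: J => [|J IHJ]; first by rewrite big_ord0 expr0 invr1 mulr1 subrr.
by rewrite big_ord_recr /= IHJ exprS invfM; field; rewrite expf_neq0 ?pnatr_eq0.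
Qed.

Lemma mean_exprn_le_of_tail (X : finType) (u W : X -> R) (th B : R) n M J :
  (forall x, 0 <= u x) -> \sum_x u x <= 1 -> 0 < th ->
  (forall x, 0 <= W x) -> (forall x, W x <= 2 ^+ J * th) -> (n < M)%N ->
  (forall s, th <= s -> \E_(x ~ u) (s <= W x)%R%:R * s ^+ M <= B) ->
  \E_(x ~ u) W x ^+ n <= th ^+ n + 2 ^+ n.+1 * (B * (th ^+ n / th ^+ M)).
Proof.
move=> u0 u1 th0 W0 WJ nM tail.
have B0 : 0 <= B.
  apply: le_trans (tail _ (lexx th)).
  by rewrite meanZr mulr_ge0 ?mean_ge0 // exprn_ge0 // ltW.
pose b := 2 ^+ n * (B * (th ^+ n / th ^+ M)).
have layer (j : 'I_J) :
    \E_(x ~ u) ((2 ^+ j.+1 * th) ^+ n * (2 ^+ j * th <= W x)%R%:R) <= b * 2 ^- j.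
  have pow_gt0 : 0 < 2 ^+ j :> R by exact: exprn_gt0.
  have s0 : 0 < 2 ^+ j * th by rewrite mulr_gt0.
  have th_le : th <= 2 ^+ j * th by rewrite ler_peMl ?(ltW th0) // exprn_ege1 //; lra.
  have {tail th_le} := tail _ th_le; rewrite meanZr -ler_pdivlMr ?exprn_gt0 // => tail_j.
  rewrite meanZ; apply: (le_trans (ler_wpM2l _ tail_j)).
    by rewrite exprn_ge0 // mulr_ge0 ?exprn_ge0 // ltW.
  rewrite exprS !exprMn invfM !mulrA /b.
  have -> : 2 ^+ n * (2 ^+ j) ^+ n * th ^+ n * B / (2 ^+ j) ^+ M / th ^+ M =
      2 ^+ n * (B * (th ^+ n / th ^+ M)) * ((2 ^+ j) ^+ n / (2 ^+ j) ^+ M) by ring.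
  have c0 : 0 <= 2 ^+ n * (B * (th ^+ n / th ^+ M)).
    by rewrite !mulr_ge0 ?invr_ge0 ?exprn_ge0 // ltW.
  rewrite !mulrA in c0 *; rewrite -[leLHS]mulrA; apply: ler_wpM2l => //.
  rewrite ler_pdivrMr ?exprn_gt0 // mulrC ler_pdivlMr // -exprSr.
  by rewrite ler_weXn2l // exprn_ege1 //; lra.
apply: (@le_trans _ _ (\E_(x ~ u) (th ^+ n +
    \sum_(j < J) (2 ^+ j.+1 * th) ^+ n * (2 ^+ j * th <= W x)%R%:R))).
  by apply: ler_mean => // x; rewrite exprn_le_dyadic_sum // ltW.
rewrite meanD mean_sum lerD //.
  by apply: mean_le => //; rewrite exprn_ge0 // ltW.
apply: (le_trans (ler_sum _ (fun j _ => layer j))).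
rewrite -mulr_sumr exprS -mulrA -/b mulrC ler_wpM2r ?sum_halves_le //.
by rewrite !mulr_ge0 ?invr_ge0 ?exprn_ge0 // ltW.
Qed.

End DyadicMoment.

Section Spread.
Variables (R : realFieldType) (X Z : finType) (u : X -> R) (w : Z -> R).

Definition rect_vol (A : pred X) (B : pred Z) : R :=
  (\E_(x ~ u) (A x)%:R) * \E_(z ~ w) (B z)%:R.

Definition rect_mass (g : X -> Z -> R) (A : pred X) (B : pred Z) : R :=
  \E_(x ~ u) \E_(z ~ w) ((A x && B z)%:R * g x z).

(* Every rectangle of volume [t >= k] has average at most [lam * t^(-1/M)]. *)
Definition spread (k lam : R) (M : nat) (g : X -> Z -> R) : Prop :=
  forall A B, k <= rect_vol A B ->
    rect_mass g A B ^+ M * rect_vol A B <= (lam * rect_vol A B) ^+ M.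

Hypotheses (u_ge0 : forall x, 0 <= u x) (w_ge0 : forall z, 0 <= w z).

Lemma rect_vol_ge0 A B : 0 <= rect_vol A B.
Proof. by rewrite mulr_ge0 // mean_ge0. Qed.

Lemma rect_mass_ge0 g A B : (forall x z, 0 <= g x z) -> 0 <= rect_mass g A B.
Proof. by move=> g0; do 2!(apply: mean_ge0 => // ?); rewrite mulr_ge0. Qed.

Lemma spread_vol_le (k lam s : R) M g A B :
  spread k lam M g -> 0 <= lam -> 0 <= s -> k * s ^+ M <= lam ^+ M ->
  s * rect_vol A B <= rect_mass g A B -> rect_vol A B * s ^+ M <= lam ^+ M.
Proof.
move=> spr lam0 s0 ks dense; have [small|large] := ltP (rect_vol A B) k.
  by apply: le_trans ks; rewrite ler_wpM2r ?exprn_ge0 // ltW.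
have [->|vol_neq0] := eqVneq (rect_vol A B) 0; first by rewrite mul0r exprn_ge0.
have vol_gt0 : 0 < rect_vol A B by rewrite lt_def vol_neq0 rect_vol_ge0.
have svol0 : 0 <= s * rect_vol A B by rewrite mulr_ge0 // ltW.
rewrite -(ler_pM2r (exprn_gt0 M vol_gt0)) -[leRHS]exprMn.
apply: le_trans (spr A B large).
rewrite -mulrA -exprMn mulrC ler_wpM2r ?(ltW vol_gt0) //.
by rewrite lerXn2r ?nnegrE // (le_trans svol0).
Qed.

Lemma exists_dense_rectangle (g : X -> Z -> R) (h : Z -> R) (L th del : R) (A : pred X) :
  (forall x z, 0 <= g x z <= L) -> (forall z, 0 <= h z <= L) -> \E_(z ~ w) h z = 1 ->
  0 <= th -> del <= 1 -> (forall x, A x -> th <= \E_(z ~ w) (h z * g x z)) ->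
  exists B : pred Z,
    del * th * \E_(x ~ u) (A x)%:R <= L ^+ 2 * rect_vol A B /\
    (1 - del) * th * rect_vol A B <= rect_mass g A B.
Proof.
move=> gL hL h1 th0 del1 thA.
have g0 x z : 0 <= g x z by case/andP: (gL x z).
have h0 z : 0 <= h z by case/andP: (hL z).
pose al := \E_(x ~ u) (A x)%:R; pose psi z := \E_(x ~ u) ((A x)%:R * g x z).
have al0 : 0 <= al by apply: mean_ge0.
have psi0 z : 0 <= psi z by apply: mean_ge0 => // x; rewrite mulr_ge0.
have psiL z : psi z <= L * al.
  by rewrite -meanZ ler_mean // => x; rewrite mulrC ler_wpM2r //; case/andP: (gL x z).
pose B z := (1 - del) * th * al <= psi z; exists B; split; last first.
  have -> : rect_mass g A B = \E_(z ~ w) ((B z)%:R * psi z).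
    rewrite /rect_mass exchange_mean; apply: eq_mean => z.
    by rewrite -meanZ; apply: eq_mean => x; rewrite -mulnb natrM mulrA [(B z)%:R * _]mulrC.
  rewrite mulrA -meanZ ler_mean // => z.
  by case: (boolP (B z)) => [Bz|_]; rewrite ?mulr0 ?mul0r // mulr1 mul1r.
have total : th * al <= \E_(z ~ w) (h z * psi z).
  have -> : \E_(z ~ w) (h z * psi z) = \E_(x ~ u) ((A x)%:R * \E_(z ~ w) (h z * g x z)).
    under eq_mean do rewrite -meanZ.
    rewrite exchange_mean; apply: eq_mean => x.
    by rewrite -meanZ; apply: eq_mean => z; rewrite mulrCA.
  rewrite -meanZ ler_mean // => x.
  by case: (boolP (A x)) => [/thA|_]; rewrite ?mulr1 ?mul1r ?mulr0 ?mul0r.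
have split_columns z :
    h z * psi z <= L ^+ 2 * al * (B z)%:R + (1 - del) * th * al * h z.
  case: (boolP (B z)) => [_|]; last first.
    by rewrite -ltNge => /ltW le_psi; rewrite mulr0 add0r mulrC ler_wpM2r.
  rewrite mulr1 -[leLHS]addr0 lerD // ?expr2 -?mulrA ?ler_pM //; last first.
    by rewrite !mulr_ge0 // subr_ge0.
  by case/andP: (hL z).
have := le_trans total (ler_mean w_ge0 split_columns).
rewrite meanD !meanZ h1 mulr1 /rect_vol -/al; lra.
Qed.

Lemma spread_tail (k lam L del th : R) M (g : X -> Z -> R) (h : Z -> R) :
  (forall x z, 0 <= g x z <= L) -> (forall z, 0 <= h z <= L) -> \E_(z ~ w) h z = 1 ->
  spread k lam M g -> 1 <= lam -> 0 <= k -> k * L ^+ M <= 1 -> 0 < del < 1 -> 1 <= th ->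
  \E_(x ~ u) (th <= \E_(z ~ w) (h z * g x z))%R%:R * th ^+ M <=
  L ^+ 2 / del * (lam / (1 - del)) ^+ M.
Proof.
move=> gL hL h1 spr lam1 k0 kL /andP[del0 del1] th1.
have lam0 : 0 <= lam by lra.
have th0 : 0 <= th by lra.
have del1' : 0 < 1 - del by lra.
have rhs0 : 0 <= L ^+ 2 / del * (lam / (1 - del)) ^+ M.
  by apply: mulr_ge0; rewrite ?exprn_ge0 ?divr_ge0 ?sqr_ge0 // ltW.
rewrite meanZr; have [le_thL|lt_Lth] := leP th L; last first.
  suff below x : \E_(z ~ w) (h z * g x z) <= L.
    by rewrite mean_eq0 ?mul0r // => x; rewrite lt_geF // (le_lt_trans (below x)).
  rewrite -[leRHS]mulr1 -[X in _ * X]h1 -meanZ ler_mean // => z.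
  by rewrite mulrC ler_wpM2r //; [case/andP: (hL z)|case/andP: (gL x z)].
have [|B [al_le dense]] := @exists_dense_rectangle g h L th del
  (fun x => th <= \E_(z ~ w) (h z * g x z)) gL hL h1 th0 (ltW del1).
  by [].
set al := \E_(x ~ u) _ in al_le *.
have al0 : 0 <= al by apply: mean_ge0.
have s0 : 0 <= (1 - del) * th by rewrite mulr_ge0 // ltW.
have ks : k * ((1 - del) * th) ^+ M <= lam ^+ M.
  apply: (@le_trans _ _ (k * L ^+ M)); last by rewrite (le_trans kL) // exprn_ege1.
  have s_leL : (1 - del) * th <= L by apply: le_trans le_thL; rewrite ler_piMl //; lra.
  by rewrite ler_wpM2l // lerXn2r ?nnegrE // (le_trans s0).
have vol_le := spread_vol_le spr lam0 s0 ks dense.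
rewrite expr_div_n mulrA ler_pdivlMr ?exprn_gt0 // -[leLHS]mulrA [th ^+ M * _]mulrC -exprMn.
rewrite mulrAC ler_pdivlMr //.
apply: (@le_trans _ _ (L ^+ 2 * rect_vol (fun x => th <= \E_(z ~ w) (h z * g x z)) B *
    ((1 - del) * th) ^+ M)).
  rewrite mulrAC ler_wpM2r ?exprn_ge0 //; apply: le_trans al_le.
  by rewrite mulrC ler_wpM2r // ler_peMr // ltW.
by rewrite -mulrA ler_wpM2l ?sqr_ge0.
Qed.

End Spread.

Section SpreadMoment.
Variables (R : realFieldType) (e M : nat).
Hypotheses (e_gt1 : (1 < e)%N) (M_large : (200 * e <= M)%N).

(* With [M >= 200 e] the decay of the tail beats the constants [2^(20 e)],
   [(2^(2 e))^2] and [(6/5)^(20 e)] attached to the moment of order [20 e]. *)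
Lemma tail_constant_le1 :
  2 ^+ (20 * e).+1 * ((2 ^+ (2 * e)) ^+ 2 / (1 / 20) *
    (101 / 100 / (1 - 1 / 20)) ^+ M * ((6 / 5) ^+ (20 * e) / (6 / 5) ^+ M)) <= 1 :> R.
Proof.
rewrite (_ : 101 / 100 / (1 - 1 / 20) = 101 / 95 :> R); last by field.
have ratio_le : (101 / 95) ^+ M / (6 / 5) ^+ M <= 2 ^- (33 * e) :> R.
  rewrite -expr_div_n; apply: (@le_trans _ _ ((8 / 9) ^+ (6 * (33 * e)))).
    apply: (@le_trans _ _ ((8 / 9) ^+ M)); first by rewrite lerXn2r ?nnegrE //; lra.
    by rewrite ler_wiXn2l //; [lra | lra | lia].
  by rewrite [leLHS]exprM -exprVn lerXn2r ?nnegrE ?exprn_ge0 //; lra.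
have power_le : (6 / 5) ^+ (20 * e) <= 2 ^+ (6 * e) :> R.
  by rewrite [leLHS]exprM [leRHS]exprM lerXn2r ?nnegrE ?exprn_ge0 //; lra.
set a := (6 / 5) ^+ (20 * e) in power_le *; set b := (6 / 5) ^+ M in ratio_le *.
set c := (101 / 95) ^+ M in ratio_le *.
apply: (@le_trans _ _
    (2 ^+ (20 * e).+1 * ((2 ^+ (2 * e)) ^+ 2 * 2 ^+ 5) * (2 ^+ (6 * e) / 2 ^+ (33 * e)))).
  have -> : 2 ^+ (20 * e).+1 * ((2 ^+ (2 * e)) ^+ 2 / (1 / 20) * c * (a / b)) =
      2 ^+ (20 * e).+1 * ((2 ^+ (2 * e)) ^+ 2 * 20) * (a * (c / b)).
    by field; apply: lt0r_neq0; rewrite exprn_gt0 //; lra.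
  apply: ler_pM.
  - by rewrite !mulr_ge0 ?exprn_ge0.
  - by rewrite !mulr_ge0 ?invr_ge0 ?exprn_ge0 //; lra.
  - by rewrite ler_wpM2l ?exprn_ge0 // ler_wpM2l ?exprn_ge0 // -natrX ler_nat.
  - by apply: ler_pM => //; rewrite ?divr_ge0 ?exprn_ge0 //; lra.
rewrite mulrA ler_pdivrMr ?exprn_gt0 // mul1r -exprM -!exprD ler_weXn2l //; first lra.
by lia.
Qed.

Section OneFunction.
Variables (X Z : finType) (u : X -> R) (w : Z -> R) (g : X -> Z -> R).
Hypotheses (u_ge0 : forall x, 0 <= u x) (u_le1 : \sum_x u x <= 1).
Hypotheses (w_ge0 : forall z, 0 <= w z) (w_sum1 : \sum_z w z = 1).
Hypothesis g_bounded : forall x z, 0 <= g x z <= 2 ^+ (2 * e).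
Hypothesis g_mean1 : forall x, \E_(z ~ w) g x z = 1.
Hypothesis g_spread : spread u w (2 ^- (2 * e * M)) (101 / 100) M g.

Lemma spread_corr_moment_le x0 :
  \E_(x ~ u) corr w g g x0 x ^+ (20 * e) <= (6 / 5) ^+ (20 * e) + 1.
Proof.
have g0 x z : 0 <= g x z by case/andP: (g_bounded x z).
have corr_le x : corr w g g x0 x <= 2 ^+ (2 * e) * (6 / 5).
  apply: (@le_trans _ _ (2 ^+ (2 * e))); last by rewrite ler_peMr ?exprn_ge0 //; lra.
  rewrite -[leRHS]mulr1 -[X in _ * X](g_mean1 x) -meanZ ler_mean // => z.
  by rewrite ler_wpM2r //; case/andP: (g_bounded x0 z).
have lt_nM : (20 * e < M)%N by lia.
have th0 : 0 < 6 / 5 :> R by lra.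
have corr0 x : 0 <= corr w g g x0 x by apply: mean_ge0 => // z; rewrite mulr_ge0.
apply: (le_trans (mean_exprn_le_of_tail u_ge0 u_le1 th0 corr0 corr_le lt_nM _)); last first.
  by rewrite lerD2l; exact: tail_constant_le1.
move=> s th_s.
apply: (spread_tail u_ge0 w_ge0 g_bounded (g_bounded x0) (g_mean1 x0) g_spread); try lra.
  by rewrite invr_ge0 exprn_ge0.
by rewrite -exprM mulVf // expf_neq0 // pnatr_eq0.
Qed.

Lemma spread_centred_moment_le :
  \E_(x ~ u) \E_(x' ~ u) corr w (centre g) (centre g) x x' ^+ (10 * e) <=
  (3 / 4) ^+ (10 * e).
Proof.
have pow_gt0 : 0 < 2 ^+ (10 * e) :> R by exact: exprn_gt0.
rewrite -(ler_pM2l pow_gt0).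
apply: (le_trans (mean_corrX_centre_le u (10 * e) w_ge0 w_sum1 g_mean1)).
apply: (@le_trans _ _ ((6 / 5) ^+ (20 * e) + 1)).
  apply: mean_le => //; first by rewrite addr_ge0 // exprn_ge0 //; lra.
  by move=> x; rewrite (_ : (10 * e).*2 = 20 * e)%N; [exact: spread_corr_moment_le | lia].
rewrite -exprMn (_ : 20 * e = 2 * (10 * e))%N; last by lia.
rewrite exprM (_ : 2 * (3 / 4) = (6 / 5) ^+ 2 * (25 / 24) :> R); last by field.
rewrite [leRHS]exprMn.
have base_ge1 : 1 <= ((6 / 5) ^+ 2) ^+ (10 * e) :> R by rewrite exprn_ege1 //; lra.
have gain : 2 <= (25 / 24) ^+ (10 * e) :> R.
  apply: (@le_trans _ _ ((25 / 24) ^+ 20)); first lra.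
  by rewrite ler_weXn2l //; [lra | lia].
apply: (@le_trans _ _ (((6 / 5) ^+ 2) ^+ (10 * e) * 2)); first lra.
by rewrite ler_pM2l //; lra.
Qed.

End OneFunction.
End SpreadMoment.

Lemma low_corr_density_le (R : realFieldType) (X Y Z : finType)
    (u : X -> R) (v : Y -> R) (w : Z -> R) (g : X -> Z -> R) (h : Y -> Z -> R)
    (f : X -> Y -> bool) (b s : R) n :
  (forall x, 0 <= u x) -> (forall y, 0 <= v y) -> (forall z, 0 <= w z) ->
  \sum_z w z = 1 -> (forall x, \E_(z ~ w) g x z = 1) -> (forall y, \E_(z ~ w) h y z = 1) ->
  ~~ odd n -> 0 <= b ->
  \E_(x ~ u) \E_(x' ~ u) corr w (centre g) (centre g) x x' ^+ n <= s ->
  \E_(y ~ v) \E_(y' ~ v) corr w (centre h) (centre h) y y' ^+ n <= s ->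
  (forall x y, f x y -> corr w g h x y <= 1 - b) ->
  (\E_(x ~ u) \E_(y ~ v) (f x y)%:R) * b ^+ n <= s.
Proof.
move=> u0 v0 w0 w1 g1 h1 even_n b0 g_le h_le f_corr.
have := mean_corrX_le w0 u v (centre g) (centre h) n.
suff : (\E_(x ~ u) \E_(y ~ v) (f x y)%:R) * b ^+ n <=
    \E_(x ~ u) \E_(y ~ v) corr w (centre g) (centre h) x y ^+ n by lra.
rewrite -meanZr ler_mean // => x; rewrite -meanZr ler_mean // => y.
rewrite corr_centre //; case: (boolP (f x y)) => [/f_corr corr_le|_]; last first.
  by rewrite mul0r exprn_even_ge0.
rewrite mul1r -[leRHS]ger0_norm ?exprn_even_ge0 // normrX.
by rewrite lerXn2r ?nnegrE // ler0_norm; lra.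
Qed.

(** * Truncation and row normalisation *)

Lemma bernoulli_exprn (R : realFieldType) (a : R) n :
  0 <= a -> 1 + n%:R * a <= (1 + a) ^+ n.
Proof.
move=> a0; elim: n => [|n IHn]; first by rewrite mul0r addr0.
rewrite exprS; have a1 : 0 <= 1 + a by lra.
apply: le_trans (ler_wpM2l a1 IHn); rewrite -natr1.
have : 0 <= n%:R * (a * a) by rewrite !mulr_ge0.
by move: (n%:R : R) => m; lra.
Qed.

(* AM-GM for [M - 1] copies of [s] and one copy of [1], multiplied by [s]. *)
Lemma exprn_le_AGM (R : realFieldType) (s : R) M :
  (0 < M)%N -> 0 <= s <= 1 -> s ^+ M <= (s + (1 - s) / M%:R) ^+ M * s.
Proof.
move=> M0 /andP[s0 s1]; have [->|s_neq0] := eqVneq s 0.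
  by rewrite mulr0 expr0n eqn0Ngt M0.
have s_gt0 : 0 < s by rewrite lt_def s_neq0.
have M_neq0 : M%:R != 0 :> R by rewrite pnatr_eq0 -lt0n.
have -> : s + (1 - s) / M%:R = s * (1 + (1 - s) / s / M%:R) by field; rewrite M_neq0.
rewrite exprMn -[leRHS]mulrA ler_peMr ?exprn_ge0 //.
apply: le_trans (ler_wpM2r s0 (bernoulli_exprn _ _)).
  by rewrite mulrCA mulfV // mulr1 mulrDl mulfVK // mul1r addrC subrK.
by rewrite !divr_ge0 // subr_ge0.
Qed.

Section Rows.
Variables (R : realFieldType) (X Z : finType) (u : X -> R) (w : Z -> R).
Hypotheses (u_ge0 : forall x, 0 <= u x) (w_ge0 : forall z, 0 <= w z).

(* Removing the row [x] cannot increase the density by much, so that the row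
   carries almost its fair share. *)
Lemma spread_row_ge (k : R) M (g : X -> Z -> R) x :
  (0 < M)%N -> \sum_x u x = 1 -> \sum_z w z = 1 ->
  \E_(x ~ u) \E_(z ~ w) g x z = 1 -> 0 < u x -> u x = 1 \/ k <= 1 - u x ->
  spread u w k 1 M g -> 1 - M%:R^-1 <= \E_(z ~ w) g x z.
Proof.
move=> M0 u1 w1 g1 ux_gt0 atom spr; set r := mean w _.
have inv_M_ge0 : 0 <= M%:R^-1 :> R by rewrite invr_ge0.
have vol_rest : rect_vol u w [pred y | y != x] predT = 1 - u x.
  rewrite /rect_vol mean_cst // mulr1.
  by rewrite -[RHS](_ : mean u (fun y => (y != x)%:R * 1) = _);
    [apply: eq_mean => y; rewrite mulr1 | rewrite mean_neqE mean_cst // mulr1].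
have mass_rest : rect_mass u w g [pred y | y != x] predT = 1 - u x * r.
  rewrite -g1 -mean_neqE; apply: eq_mean => y.
  by rewrite -meanZ; apply: eq_mean => z; rewrite andbT.
have [ux1|ux_neq1] := eqVneq (u x) 1.
  suff -> : r = 1 by rewrite gerBl.
  have rest_sum0 : \sum_(y | y != x) u y = 0.
    by move: u1; rewrite (bigD1 x) //= ux1 -[RHS]addr0 => /addrI.
  have rest0 : forall y, y != x -> u y = 0 by apply: psumr_eq0P.
  rewrite -g1 /mean [RHS](bigD1 x) //= ux1 mul1r [X in _ = _ + X]big1 ?addr0 //.
  by move=> y /rest0 ->; rewrite mul0r.
have ux_lt1 : u x < 1 by rewrite lt_def eq_sym ux_neq1 -u1 (bigD1 x) //= lerDl sumr_ge0.
have k_le : k <= 1 - u x by case: atom => // ux1; rewrite ux1 eqxx in ux_neq1.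
have := spr [pred y | y != x] predT; rewrite vol_rest mass_rest mul1r => /(_ k_le) mass_le.
have AGM : (1 - u x) ^+ M <= (1 - u x + u x / M%:R) ^+ M * (1 - u x).
  by have := @exprn_le_AGM _ (1 - u x) M M0; rewrite subKr; apply; lra.
have := le_trans mass_le AGM; rewrite ler_pM2r ?subr_gt0 //.
apply: contraTle => r_lt.
have gap : 1 - u x + u x / M%:R < 1 - u x * r.
  by have := ltr_pM2l ux_gt0 r (1 - M%:R^-1); rewrite r_lt; lra.
have avg_ge0 : 0 <= 1 - u x + u x / M%:R by rewrite addr_ge0 ?mulr_ge0 ?subr_ge0 // ltW.
by rewrite -ltNge ltrXn2r ?nnegrE -?lt0n // ltW // (le_lt_trans avg_ge0).
Qed.

Definition truncate (L : R) (g : X -> Z -> R) (x : X) (z : Z) : R :=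
  if g x z <= L then g x z else 0.

Definition heavy (lam : R) (g : X -> Z -> R) (x : X) : bool :=
  1 <= lam * \E_(z ~ w) g x z.

Definition row_normalise (lam : R) (g : X -> Z -> R) (x : X) (z : Z) : R :=
  if heavy lam g x then g x z / \E_(z' ~ w) g x z' else 1.

Definition restrict (H : pred X) (x : X) : R := u x * (H x)%:R.

(* [tau] is the density below which evasiveness gives no bound. *)
Definition mass_bounded (K tau : R) (g : X -> Z -> R) : Prop :=
  forall S : X -> Z -> bool,
    \E_(x ~ u) \E_(z ~ w) ((S x z)%:R * g x z) <=
    K * Num.max (\E_(x ~ u) \E_(z ~ w) (S x z)%:R) tau.

Lemma mean_restrict (H : pred X) F :
  \E_(x ~ restrict H) F x = \E_(x ~ u) ((H x)%:R * F x).
Proof. by apply: eq_bigr => x _; rewrite mulrA. Qed.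

Lemma truncate_ge0_le (L : R) g x z :
  (forall x z, 0 <= g x z) -> 0 <= truncate L g x z <= g x z.
Proof. by rewrite /truncate => g0; case: ifP; rewrite !g0 lexx. Qed.

Section RowNormalise.
Variables (lam : R) (g : X -> Z -> R).
Hypotheses (lam_gt0 : 0 < lam) (g_ge0 : forall x z, 0 <= g x z).

Lemma heavy_mean_gt0 x : heavy lam g x -> 0 < \E_(z ~ w) g x z.
Proof. by move=> /(lt_le_trans ltr01); rewrite pmulr_rgt0. Qed.

Lemma mean_row_normalise x : \sum_z w z = 1 -> \E_(z ~ w) row_normalise lam g x z = 1.
Proof.
move=> w1; rewrite /row_normalise.
case: (heavy lam g x) / boolP => [/heavy_mean_gt0 r_gt0|_]; last exact: mean_cst.
by rewrite meanZr divff // gt_eqF.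
Qed.

Lemma row_normalise_ge0 x z : 0 <= row_normalise lam g x z.
Proof. by rewrite /row_normalise; case: ifP => // _; rewrite divr_ge0 ?mean_ge0. Qed.

Lemma row_normalise_le x z : heavy lam g x -> row_normalise lam g x z <= lam * g x z.
Proof.
move=> x_heavy; rewrite /row_normalise x_heavy ler_pdivrMr ?heavy_mean_gt0 //.
by rewrite mulrAC ler_peMl.
Qed.

Lemma row_normalise_bounded (L : R) x z :
  1 <= lam * L -> (forall x z, g x z <= L) -> row_normalise lam g x z <= lam * L.
Proof.
move=> L1 gL; have [x_heavy|x_light] := boolP (heavy lam g x).
  by apply: (le_trans (row_normalise_le _ x_heavy)); rewrite ler_pM2l.
by rewrite /row_normalise (negbTE x_light).
Qed.

Lemma spread_row_normalise (g' : X -> Z -> R) (k mu : R) M :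
  (forall x z, g x z <= g' x z) -> spread u w k mu M g' ->
  spread (restrict (heavy lam g)) w k (lam * mu) M (row_normalise lam g).
Proof.
move=> gg' spr A B; pose A' := predI (heavy lam g) A.
have -> : rect_vol (restrict (heavy lam g)) w A B = rect_vol u w A' B.
  by rewrite /rect_vol mean_restrict; under eq_mean do rewrite -natrM mulnb.
move=> /spr spr_AB.
have mass_le : rect_mass (restrict (heavy lam g)) w (row_normalise lam g) A B <=
    lam * rect_mass u w g' A' B.
  rewrite /rect_mass mean_restrict -meanZ ler_mean // => x /=.
  case: (boolP (heavy lam g x)) => [x_heavy|_]; last first.
    rewrite mul0r mulr_ge0 ?(ltW lam_gt0) ?mean_ge0 // => z.
    by rewrite mulr_ge0 // (le_trans (g_ge0 x z)).
  rewrite mul1r -meanZ ler_mean // => z; rewrite mulrCA ler_wpM2l //.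
  by rewrite (le_trans (row_normalise_le z x_heavy)) // ler_pM2l.
have mass_ge0 : 0 <= rect_mass (restrict (heavy lam g)) w (row_normalise lam g) A B.
  by apply: rect_mass_ge0 => // [x|]; [rewrite mulr_ge0 | exact: row_normalise_ge0].
apply: (@le_trans _ _ ((lam * rect_mass u w g' A' B) ^+ M * rect_vol u w A' B)).
  by rewrite ler_wpM2r ?rect_vol_ge0 // lerXn2r ?nnegrE // (le_trans mass_ge0).
by rewrite -[lam * mu * _]mulrA exprMn [leRHS]exprMn -mulrA ler_wpM2l // exprn_ge0 // ltW.
Qed.

End RowNormalise.

Section MassBounded.
Variables (K tau : R) (g : X -> Z -> R).
Hypotheses (K_gt0 : 0 < K) (tau_ge0 : 0 <= tau) (g_ge0 : forall x z, 0 <= g x z).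
Hypothesis g_bounded : mass_bounded K tau g.

(* The set [2 * K < g] is so small that only the cutoff [tau] bounds its mass. *)
Lemma large_values_mass_le :
  \E_(x ~ u) \E_(z ~ w) ((2 * K < g x z)%R%:R * g x z) <= K * tau.
Proof.
have mass_le := g_bounded (fun x z => 2 * K < g x z).
apply: (le_trans mass_le); rewrite ler_pM2l // ge_max lexx andbT.
set vol := (X in X <= tau); rewrite -/vol in mass_le.
have vol0 : 0 <= vol by apply: mean_ge0 => // x; exact: mean_ge0.
have mass_ge : 2 * K * vol <=
    \E_(x ~ u) \E_(z ~ w) ((2 * K < g x z)%R%:R * g x z).
  rewrite -meanZ ler_mean // => x; rewrite -meanZ ler_mean // => z.
  by case: ltP => [/ltW|_]; rewrite ?mulr0 ?mul0r ?mulr1 ?mul1r.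
have := le_trans mass_ge mass_le; rewrite -mulrA mulrCA ler_pM2l // le_max.
by move: tau_ge0 => tau0 /orP[]; lra.
Qed.

Lemma light_rows_le (lam del : R) :
  0 < lam -> (forall x, 0 < u x -> lam^-1 + del <= \E_(z ~ w) g x z) ->
  del * \E_(x ~ u) (~~ heavy lam (truncate (2 * K) g) x)%:R <= K * tau.
Proof.
move=> lam_gt0 row_ge; apply: le_trans large_values_mass_le.
rewrite -meanZ; apply: ler_sum => x _.
have [->|ux_neq0] := eqVneq (u x) 0; first by rewrite !mul0r.
rewrite ler_wpM2l //; case: (boolP (heavy _ _ _)) => [_|].
  by rewrite mulr0; apply: mean_ge0 => // z; rewrite mulr_ge0.
rewrite mulr1 -ltNge -ltr_pdivlMl // mulr1.
have := row_ge x; rewrite lt_def ux_neq0 u_ge0 => /(_ isT).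
rewrite (@eq_mean _ _ _ _ (fun z => (2 * K < g x z)%R%:R * g x z + truncate (2 * K) g x z)).
  by rewrite meanD; lra.
by move=> z; rewrite /truncate; case: ltP => _; rewrite ?mul1r ?mul0r ?addr0 ?add0r.
Qed.

End MassBounded.

End Rows.

(** * Cylinder intersections supporting a regular density *)

Lemma exp2_div_le (R : realFieldType) (a b c : nat) :
  (a + c <= b)%N -> 2 ^+ a / 2 ^+ b <= 2 ^- c :> R.
Proof.
move=> le_b; rewrite ler_pdivrMr ?exprn_gt0 // mulrC ler_pdivlMr ?exprn_gt0 //.
by rewrite -exprD ler_weXn2l //; lra.
Qed.

Section Regular.
Variables (R : realFieldType) (e M : nat).

(* For [e = 2 * d] a box of maximal potential provides exactly these constants. *)
Definition regular (X Z : finType) (u : X -> R) (w : Z -> R) (g : X -> Z -> R) : Prop :=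
  [/\ forall x z, 0 <= g x z, \E_(x ~ u) \E_(z ~ w) g x z = 1,
      mass_bounded u w (2 ^+ e) (2 ^- (8 * e)) g &
      spread u w (2 ^- (2 * e * M)) 1 M g].

Definition balance (X Z : finType) (w : Z -> R) (g : X -> Z -> R) : X -> Z -> R :=
  row_normalise w (101 / 100) (truncate (2 * 2 ^+ e) g).

Definition kept (X Z : finType) (w : Z -> R) (g : X -> Z -> R) : pred X :=
  heavy w (101 / 100) (truncate (2 * 2 ^+ e) g).

Hypotheses (e_gt1 : (1 < e)%N) (M_large : (200 * e <= M)%N).

Section Balance.
Variables (X Z : finType) (u : X -> R) (w : Z -> R) (g : X -> Z -> R).
Hypotheses (u_ge0 : forall x, 0 <= u x) (u_sum1 : \sum_x u x = 1).
Hypothesis u_atoms : forall x, u x = 1 \/ u x <= 1 / 2.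
Hypotheses (w_ge0 : forall z, 0 <= w z) (w_sum1 : \sum_z w z = 1).
Hypothesis g_regular : regular u w g.

Let g_ge0 x z : 0 <= g x z. Proof. by case: g_regular. Qed.

Let trunc_ge0 x z : 0 <= truncate (2 * 2 ^+ e) g x z.
Proof. by case/andP: (truncate_ge0_le (2 * 2 ^+ e) x z g_ge0). Qed.

Let lam_gt0 : 0 < 101 / 100 :> R. Proof. by lra. Qed.

Lemma mean_balance x : \E_(z ~ w) balance w g x z = 1.
Proof. exact: mean_row_normalise. Qed.

Lemma balance_bounded x z : 0 <= balance w g x z <= 2 ^+ (2 * e).
Proof.
rewrite row_normalise_ge0 //=.
have K_ge1 : 1 <= 2 ^+ e :> R by rewrite exprn_ege1 //; lra.
apply: (@le_trans _ _ (101 / 100 * (2 * 2 ^+ e))).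
  apply: row_normalise_bounded => // [|x' z']; first by lra.
  by rewrite /truncate; case: ifP => // _; lra.
apply: (@le_trans _ _ (2 ^+ (2 + e))); first by rewrite exprD; lra.
by rewrite ler_weXn2l //; [lra | lia].
Qed.

Lemma balance_eq0 x z : kept w g x -> g x z = 0 -> balance w g x z = 0.
Proof.
move=> x_kept g0; rewrite /balance /row_normalise -/(kept w g x) x_kept.
by rewrite [truncate _ _ _ _](_ : _ = 0) ?mul0r // /truncate g0; case: ifP.
Qed.

Lemma balance_moment_le :
  \E_(x ~ restrict u (kept w g)) \E_(x' ~ restrict u (kept w g))
    corr w (centre (balance w g)) (centre (balance w g)) x x' ^+ (10 * e) <=
  (3 / 4) ^+ (10 * e).
Proof.
apply: (spread_centred_moment_le e_gt1 M_large) => //.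
- by move=> x; rewrite mulr_ge0.
- by rewrite -u_sum1 ler_sum // => x _; rewrite ler_piMr // lern1 leq_b1.
- exact: balance_bounded.
- exact: mean_balance.
rewrite -[101 / 100]mulr1; case: g_regular => _ _ _ spr.
apply: spread_row_normalise spr => // x z.
by case/andP: (truncate_ge0_le (2 * 2 ^+ e) x z g_ge0).
Qed.

Lemma dropped_mass_le : \E_(x ~ u) \E_(z ~ w) ((~~ kept w g x)%:R * g x z) <= 1 / 8.
Proof.
case: g_regular => _ g_mean1 bounded spr.
have K_gt0 : 0 < 2 ^+ e :> R by exact: exprn_gt0.
have tau_ge0 : 0 <= 2 ^- (8 * e) :> R by rewrite invr_ge0 exprn_ge0.
have inv_M : M%:R^-1 <= 1 / 202 :> R.
  by rewrite div1r lef_pV2 ?posrE ?ltr0n ?ler_nat //; lia.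
have row_ge x : 0 < u x -> (101 / 100)^-1 + 1 / 202 <= \E_(z ~ w) g x z.
  move=> ux_gt0; apply: (@le_trans _ _ (1 - M%:R^-1)).
    by rewrite (_ : (101 / 100)^-1 = 100 / 101 :> R); [lra | field].
  apply: (spread_row_ge u_ge0 _ u_sum1 w_sum1 g_mean1 ux_gt0 _ spr); first by lia.
  case: (u_atoms x) => [->|ux_le]; [by left | right].
  apply: (@le_trans _ _ (2 ^- 1)); last by lra.
  by rewrite -[leLHS]mul1r; apply: (exp2_div_le _ (a := 0)); nia.
have light_le := light_rows_le u_ge0 w_ge0 K_gt0 tau_ge0 g_ge0 bounded lam_gt0 row_ge.
have := bounded (fun x _ => ~~ kept w g x).
under [X in _ <= _ * Num.max X _]eq_mean do rewrite mean_cst //.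
move/le_trans; apply; apply: (@le_trans _ _ (2 ^+ e * (202 * (2 ^+ e * 2 ^- (8 * e))))).
  rewrite ler_pM2l // ge_max; apply/andP; split; first by rewrite /kept; lra.
  have K_ge1 : 1 <= 2 ^+ e :> R by rewrite exprn_ege1 //; lra.
  by rewrite mulrA ler_peMl //; lra.
rewrite mulrCA [X in _ * X]mulrA -exprD.
apply: (@le_trans _ _ (2 ^+ 8 * (2 ^+ (e + e) / 2 ^+ (8 * e)))).
  by rewrite ler_wpM2r ?divr_ge0 ?exprn_ge0 // -natrX ler_nat.
rewrite mulrA -exprD; apply: (@le_trans _ _ (2 ^- 3)); last by lra.
by apply: exp2_div_le; lia.
Qed.

End Balance.

Section Cylinder.
Variables (X Y Z : finType) (u : X -> R) (v : Y -> R) (w : Z -> R).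
Hypotheses (u_ge0 : forall x, 0 <= u x) (u_sum1 : \sum_x u x = 1).
Hypotheses (v_ge0 : forall y, 0 <= v y) (v_sum1 : \sum_y v y = 1).
Hypotheses (w_ge0 : forall z, 0 <= w z) (w_sum1 : \sum_z w z = 1).
Hypothesis u_atoms : forall x, u x = 1 \/ u x <= 1 / 2.
Hypothesis v_atoms : forall y, v y = 1 \/ v y <= 1 / 2.

Variables (q : X -> Y -> Z -> R).
Variables (f : X -> Y -> bool) (g : X -> Z -> bool) (h : Y -> Z -> bool).
Let G x z := \E_(y ~ v) q x y z.
Let H y z := \E_(x ~ u) q x y z.
Let P x y := \E_(z ~ w) q x y z.
Hypothesis q_ge0 : forall x y z, 0 <= q x y z.
Hypothesis q_supp : forall x y z, q x y z != 0 -> [&& f x y, g x z & h y z].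
Hypotheses (G_regular : regular u w G) (H_regular : regular v w H).
Hypothesis P_bounded : mass_bounded u v (2 ^+ e) (2 ^- (8 * e)) P.

Let g' := balance w G.
Let h' := balance w H.
Let kept_f x y := [&& kept w G x, kept w H y & f x y].

Lemma kept_mass_ge : 3 / 4 <= \E_(x ~ u) \E_(y ~ v) ((kept_f x y)%:R * P x y).
Proof.
have P_ge0 x y : 0 <= P x y by apply: mean_ge0.
have P_mean1 : \E_(x ~ u) \E_(y ~ v) P x y = 1.
  case: G_regular => _ <- _ _; apply: eq_mean => x; exact: exchange_mean.
have drop_x : \E_(x ~ u) \E_(y ~ v) ((~~ kept w G x)%:R * P x y) <= 1 / 8.
  apply: le_trans (dropped_mass_le u_ge0 u_sum1 u_atoms w_ge0 w_sum1 G_regular).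
  rewrite le_eqVlt; apply/orP; left; apply/eqP/eq_mean => x.
  by rewrite !meanZ exchange_mean.
have drop_y : \E_(x ~ u) \E_(y ~ v) ((~~ kept w H y)%:R * P x y) <= 1 / 8.
  apply: le_trans (dropped_mass_le v_ge0 v_sum1 v_atoms w_ge0 w_sum1 H_regular).
  rewrite exchange_mean le_eqVlt; apply/orP; left; apply/eqP/eq_mean => y.
  by rewrite !meanZ exchange_mean.
suff : 1 <= \E_(x ~ u) \E_(y ~ v) ((~~ kept w G x)%:R * P x y) +
    \E_(x ~ u) \E_(y ~ v) ((~~ kept w H y)%:R * P x y) +
    \E_(x ~ u) \E_(y ~ v) ((kept_f x y)%:R * P x y) by lra.
rewrite -!meanD -[leLHS]P_mean1 ler_mean // => x; rewrite -!meanD ler_mean // => y.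
have Pf : ~~ f x y -> P x y = 0.
  move=> not_f; apply: mean_eq0 => z.
  by apply/eqP; apply: contraNT not_f => /q_supp/and3P[].
rewrite /kept_f; have := P_ge0 x y.
case: (boolP (f x y)) => [_|/Pf ->]; last by rewrite !mulr0 !addr0.
by case: (kept w G x); case: (kept w H y) => /=; rewrite ?mul0r ?mul1r; lra.
Qed.

Lemma kept_density_ge : 3 / 4 <= 2 ^+ e * \E_(x ~ u) \E_(y ~ v) (kept_f x y)%:R.
Proof.
have tau_le : 2 ^+ e * 2 ^- (8 * e) <= 2 ^- 1 :> R by apply: exp2_div_le; lia.
have := le_trans kept_mass_ge (P_bounded kept_f).
by rewrite maxEle; case: ifP => // _ /le_trans/(_ tau_le); rewrite expr1; lra.
Qed.

Lemma kept_low_corr_density_le :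
  \E_(x ~ u) \E_(y ~ v) (kept_f x y && (corr w g' h' x y <= 1 / 8)%R)%:R <=
  (6 / 7) ^+ (10 * e).
Proof.
pose low x y := f x y && (corr w g' h' x y <= 1 / 8)%R.
have -> : \E_(x ~ u) \E_(y ~ v) (kept_f x y && (corr w g' h' x y <= 1 / 8)%R)%:R =
    \E_(x ~ restrict u (kept w G)) \E_(y ~ restrict v (kept w H)) (low x y)%:R.
  rewrite mean_restrict; apply: eq_mean => x; rewrite mean_restrict -meanZ.
  by apply: eq_mean => y; rewrite -!natrM !mulnb /kept_f /low !andbA.
have pow_gt0 : 0 < (7 / 8) ^+ (10 * e) :> R by rewrite exprn_gt0 //; lra.
rewrite -(ler_pM2r pow_gt0) -exprMn (_ : 6 / 7 * (7 / 8) = 3 / 4 :> R); last by field.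
have restrict_ge0 (T : finType) (p : T -> R) (A : pred T) x :
  (forall x, 0 <= p x) -> 0 <= restrict p A x by move=> p_ge0; rewrite mulr_ge0.
apply: (low_corr_density_le (g := g') (h := h') _ _ w_ge0 w_sum1).
- by move=> x; exact: restrict_ge0.
- by move=> y; exact: restrict_ge0.
- by move=> x; exact: mean_balance.
- by move=> y; exact: mean_balance.
- by rewrite oddM.
- by lra.
- exact: balance_moment_le.
- exact: balance_moment_le.
by move=> x y /andP[_ corr_le]; lra.
Qed.

Lemma kept_high_corr_density_le :
  \E_(x ~ u) \E_(y ~ v) (kept_f x y && (1 / 8 < corr w g' h' x y)%R)%:R <=
  8 * 2 ^+ (4 * e) *
    \E_(x ~ u) \E_(y ~ v) \E_(z ~ w) [&& f x y, g x z & h y z]%:R.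
Proof.
rewrite -meanZ ler_mean // => x; rewrite -meanZ ler_mean // => y.
have F_ge0 : 0 <= \E_(z ~ w) [&& f x y, g x z & h y z]%:R :> R by exact: mean_ge0.
case: (boolP (_ && _)) => [/andP[/and3P[kx ky fxy] high]|_]; last first.
  by rewrite !mulr_ge0 ?exprn_ge0.
suff corr_le : corr w g' h' x y <= 2 ^+ (4 * e) * \E_(z ~ w) [&& f x y, g x z & h y z]%:R.
  by rewrite /=; lra.
rewrite -meanZ ler_mean // => z; rewrite fxy /=.
have g'0 : ~~ g x z -> g' x z = 0.
  move=> not_g; apply: balance_eq0 => //; apply: mean_eq0 => y'.
  by apply/eqP; apply: contraNT not_g => /q_supp/and3P[].
have h'0 : ~~ h y z -> h' y z = 0.
  move=> not_h; apply: balance_eq0 => //; apply: mean_eq0 => x'.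
  by apply/eqP; apply: contraNT not_h => /q_supp/and3P[].
case: (boolP (g x z)) => [_|/g'0 ->]; last by rewrite mul0r mulr0.
case: (boolP (h y z)) => [_|/h'0 ->]; last by rewrite !mulr0.
rewrite mulr1 (_ : 4 * e = 2 * e + 2 * e)%N; last by lia.
have /andP[g'_ge0 g'_le] := balance_bounded w_ge0 G_regular x z.
have /andP[h'_ge0 h'_le] := balance_bounded w_ge0 H_regular y z.
by rewrite exprD ler_pM.
Qed.

Lemma regular_cylinder_density_ge :
  2 ^- (7 * e) <= \E_(x ~ u) \E_(y ~ v) \E_(z ~ w) [&& f x y, g x z & h y z]%:R.
Proof.
set F := \E_(x ~ u) _.
have split_corr : \E_(x ~ u) \E_(y ~ v) (kept_f x y)%:R <=
    (6 / 7) ^+ (10 * e) + 8 * 2 ^+ (4 * e) * F.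
  apply: le_trans (lerD kept_low_corr_density_le kept_high_corr_density_le).
  rewrite -meanD ler_mean // => x; rewrite -meanD ler_mean // => y.
  by case: (kept_f x y); case: leP; rewrite /= ?addr0 ?add0r.
have K_gt0 : 0 < 2 ^+ e :> R by exact: exprn_gt0.
have low_le : 2 ^+ e * (6 / 7) ^+ (10 * e) <= 1 / 4 :> R.
  apply: (@le_trans _ _ (2 ^+ e * 2 ^- (2 * e))).
    rewrite ler_pM2l // (_ : 10 * e = 5 * (2 * e))%N; last by lia.
    by rewrite [leLHS]exprM -exprVn lerXn2r ?nnegrE ?exprn_ge0 ?invr_ge0 //; lra.
  apply: (@le_trans _ _ (2 ^- 2)); last by lra.
  by apply: exp2_div_le; lia.
have := le_trans kept_density_ge (ler_wpM2l (ltW K_gt0) split_corr).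
rewrite mulrDr => mass_le.
have : 1 / 2 <= 2 ^+ 3 * 2 ^+ (5 * e) * F.
  rewrite (_ : 5 * e = e + 4 * e)%N; last by lia.
  rewrite exprD; move: mass_le low_le.
  by move: (2 ^+ e : R) (2 ^+ (4 * e) : R) ((6 / 7) ^+ (10 * e) : R) => K K4 low; lra.
rewrite -exprD -ler_pdivrMl ?exprn_gt0 //; apply: le_trans.
rewrite div1r -invfM -exprSr -[leLHS]mul1r; apply: (exp2_div_le _ (a := 0)); lia.
Qed.

End Cylinder.
End Regular.

(** * Regularity inside a box of maximal potential *)

Section Density.
Variables (R : realFieldType) (T : finType).
Implicit Types E S b : {set T}.

Definition density E S : R := #|E :&: S|%:R / #|S|%:R.

Lemma density_ge0 E S : 0 <= density E S.
Proof. by rewrite divr_ge0. Qed.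

Lemma density_gt0_card E S : 0 < density E S -> 0 < #|S|%:R :> R.
Proof.
move=> dens_gt0; rewrite ltr0n lt0n; apply: contraTneq dens_gt0 => S0.
by rewrite /density S0 invr0 mulr0 ltxx.
Qed.

(* The potential [density ^ M * volume] trades density against volume: its
   maximiser is at least as dense as the whole space, and not much smaller. *)
Lemma exists_max_potential (I : finType) (b : I -> {set T}) (E : {set T}) (i0 : I)
    (rho kappa eta : R) M :
  (0 < M)%N -> (0 < #|T|)%N -> b i0 = setT -> 0 < kappa -> 0 < rho -> eta <= 1 ->
  rho / kappa <= density E setT ->
  (forall i, eta * #|T|%:R <= #|b i|%:R -> density E (b i) <= kappa * rho) ->
  exists i, [/\ #|T|%:R <= kappa ^+ (2 * M) * #|b i|%:R, rho / kappa <= density E (b i) &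
    forall j, eta * #|T|%:R <= #|b j|%:R ->
      density E (b j) ^+ M * #|b j|%:R <= density E (b i) ^+ M * #|b i|%:R].
Proof.
move=> M_gt0 T_gt0 b_i0 kappa_gt0 rho_gt0 eta_le1 dense_T dens_le.
have T_gt0' : 0 < #|T|%:R :> R by rewrite ltr0n.
have large_i0 : eta * #|T|%:R <= #|b i0|%:R by rewrite b_i0 cardsT ler_piMl // ltW.
pose large i := eta * #|T|%:R <= #|b i|%:R.
have [i large_i i_max] :=
  @arg_maxP _ _ _ i0 large (fun i => density E (b i) ^+ M * #|b i|%:R) large_i0.
have base_ge0 : 0 <= rho / kappa by rewrite divr_ge0 // ltW.
have potential_ge : (rho / kappa) ^+ M * #|T|%:R <= density E (b i) ^+ M * #|b i|%:R.
  apply: le_trans (i_max _ large_i0).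
  by rewrite b_i0 cardsT ler_pM2r // lerXn2r ?nnegrE ?density_ge0.
exists i; split=> //.
  have : (rho / kappa) ^+ M * #|T|%:R <= (kappa * rho) ^+ M * #|b i|%:R.
    apply: (le_trans potential_ge); rewrite ler_wpM2r // lerXn2r ?nnegrE ?density_ge0 //.
      by rewrite mulr_ge0 // ltW.
    exact: dens_le.
  have -> : kappa * rho = kappa ^+ 2 * (rho / kappa) by field; rewrite gt_eqF.
  rewrite [(kappa ^+ 2 * _) ^+ M]exprMn -exprM [leRHS]mulrAC [leLHS]mulrC ler_pM2r //.
  by rewrite exprn_gt0 // divr_gt0.
rewrite -(@ler_pXn2r _ M) ?nnegrE ?density_ge0 // -(ler_pM2r T_gt0').
apply: (le_trans potential_ge).
by rewrite ler_wpM2l ?exprn_ge0 ?density_ge0 // ler_nat max_card.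
Qed.

Lemma subset_density_le E b b' M :
  0 < density E b ->
  density E b' ^+ M * #|b'|%:R <= density E b ^+ M * #|b|%:R ->
  (#|E :&: b'|%:R / #|b|%:R / density E b) ^+ M * (#|b'|%:R / #|b|%:R) <=
  (#|b'|%:R / #|b|%:R) ^+ M :> R.
Proof.
move=> dens_gt0 potential_le.
have b_gt0 := density_gt0_card dens_gt0.
set m := density E b in dens_gt0 potential_le *; set t := #|b'|%:R / #|b|%:R.
have t_ge0 : 0 <= t by rewrite divr_ge0.
have -> : #|E :&: b'|%:R / #|b|%:R / m = density E b' * t / m.
  have [b'0|b'_neq0] := eqVneq #|b'| 0%N.
    rewrite /t b'0 mul0r mulr0 (_ : #|E :&: b'| = 0%N) ?mul0r //.
    by apply/eqP; rewrite -leqn0 -b'0 subset_leq_card // subsetIr.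
  by rewrite /density mulrA divfK // pnatr_eq0.
rewrite expr_div_n exprMn.
rewrite (_ : _ * t = t ^+ M * (density E b' ^+ M * t / m ^+ M)); last by ring.
rewrite ler_piMr ?exprn_ge0 // ler_pdivrMr ?exprn_gt0 // mul1r.
by rewrite /t mulrA ler_pdivrMr.
Qed.

Lemma slice_mass_le E S b (rho kappa tau tau' : R) :
  0 < kappa -> 0 < rho -> 0 < #|b|%:R :> R -> rho / kappa <= density E b ->
  #|E :&: (S :&: b)|%:R <= kappa * rho * Num.max #|S :&: b|%:R tau' ->
  tau' <= tau * #|b|%:R ->
  #|E :&: (S :&: b)|%:R / #|b|%:R / density E b <=
  kappa ^+ 2 * Num.max (#|S :&: b|%:R / #|b|%:R) tau.
Proof.
move=> kappa_gt0 rho_gt0 b_gt0 dens_ge mass_le tau_le.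
have dens_gt0 : 0 < density E b by apply: lt_le_trans dens_ge; rewrite divr_gt0.
rewrite ler_pdivrMr // ler_pdivrMr //; apply: (le_trans mass_le).
apply: (@le_trans _ _ (kappa * rho * (Num.max (#|S :&: b|%:R / #|b|%:R) tau * #|b|%:R))).
  rewrite ler_pM2l ?mulr_gt0 // maxr_pMl ?(ltW b_gt0) // divfK ?gt_eqF //.
  by rewrite ge_max le_max lexx /= le_max tau_le orbT.
set V := Num.max _ _; have V_ge0 : 0 <= V by rewrite le_max divr_ge0.
rewrite [leRHS](_ : _ = kappa ^+ 2 * density E b * (V * #|b|%:R)); last by ring.
rewrite ler_wpM2r ?mulr_ge0 ?(ltW b_gt0) // expr2 -mulrA ler_pM2l //.
by rewrite mulrC -ler_pdivrMr.
Qed.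

End Density.

Section Uniform.
Variables (R : realFieldType) (X : finType) (A : {set X}).

Definition unif (x : X) : R := (x \in A)%:R / #|A|%:R.

Lemma unif_ge0 x : 0 <= unif x.
Proof. by rewrite divr_ge0. Qed.

Lemma mean_unif F : \E_(x ~ unif) F x = (\sum_(x in A) F x) / #|A|%:R.
Proof.
rewrite mulr_suml [RHS]big_mkcond; apply: eq_bigr => x _.
by rewrite mulrAC /unif; case: (x \in A); rewrite ?mul1r ?mul0r.
Qed.

Lemma sum_unif : A != set0 -> \sum_x unif x = 1.
Proof.
move=> A_neq0; rewrite -mulr_suml -natr_sum -big_mkcond sum1_card divff //.
by rewrite pnatr_eq0 cards_eq0.
Qed.

Lemma unif_atoms x : unif x = 1 \/ unif x <= 1 / 2.
Proof.
rewrite /unif; case: (x \in A); last by right; rewrite mul0r; lra.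
case: #|A| => [|[|n]]; [right | left | right]; first by rewrite invr0 mulr0; lra.
  by rewrite divr1.
by rewrite ler_pM2l // lef_pV2 ?posrE ?ltr0n // ler_nat.
Qed.

End Uniform.

Section Box.
Variables (R : realFieldType) (X Y Z : finType).
Implicit Types (E : {set X * Y * Z}) (A : {set X}) (B : {set Y}) (C : {set Z}).

Definition box A B C : {set X * Y * Z} := setX (setX A B) C.

Lemma card_box A B C : #|box A B C| = (#|A| * #|B| * #|C|)%N.
Proof. by rewrite !cardsX. Qed.

Definition cyl_xy (S : X -> Y -> bool) : {set X * Y * Z} := [set p | S p.1.1 p.1.2].
Definition cyl_xz (S : X -> Z -> bool) : {set X * Y * Z} := [set p | S p.1.1 p.2].
Definition cyl_yz (S : Y -> Z -> bool) : {set X * Y * Z} := [set p | S p.1.2 p.2].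

Lemma mean_box E A B C :
  \E_(x ~ unif R A) \E_(y ~ unif R B) \E_(z ~ unif R C) ((x, y, z) \in E)%:R =
  #|E :&: box A B C|%:R / #|box A B C|%:R.
Proof.
rewrite card_box mean_unif.
under eq_bigr do rewrite mean_unif.
under eq_bigr do under eq_bigr do rewrite mean_unif.
under eq_bigr do rewrite -mulr_suml -mulrA -invfM.
rewrite -mulr_suml -mulrA -invfM -!natrM [(#|C| * _)%N]mulnC [(_ * #|A|)%N]mulnC mulnA.
congr (_ / _); rewrite pair_big /= pair_big /= -natr_sum -big_mkcondr /= sum1_card.
by congr (_%:R); apply: eq_card => -[[x y] z]; rewrite !inE andbC.
Qed.

Section BoxMarginals.
Variables (A : {set X}) (B : {set Y}) (C : {set Z}).
Hypotheses (A_neq0 : A != set0) (B_neq0 : B != set0) (C_neq0 : C != set0).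
Variables (E : {set X * Y * Z}) (k : R).
Let b := box A B C.

Lemma mean_cyl_xy (S : X -> Y -> bool) :
  \E_(x ~ unif R A) \E_(y ~ unif R B) (S x y)%:R = #|cyl_xy S :&: b|%:R / #|b|%:R.
Proof.
rewrite -mean_box; apply: eq_mean => x; apply: eq_mean => y.
by under [RHS]eq_mean do rewrite inE /=; rewrite mean_cst ?sum_unif.
Qed.

Lemma mean_cyl_xz (S : X -> Z -> bool) :
  \E_(x ~ unif R A) \E_(z ~ unif R C) (S x z)%:R = #|cyl_xz S :&: b|%:R / #|b|%:R.
Proof.
rewrite -mean_box; apply: eq_mean => x; rewrite [RHS]exchange_mean.
by apply: eq_mean => z; under [RHS]eq_mean do rewrite inE /=; rewrite mean_cst ?sum_unif.
Qed.

Lemma mean_cyl_yz (S : Y -> Z -> bool) :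
  \E_(y ~ unif R B) \E_(z ~ unif R C) (S y z)%:R = #|cyl_yz S :&: b|%:R / #|b|%:R.
Proof.
rewrite -mean_box [RHS]exchange_mean; apply: eq_mean => y.
rewrite [RHS]exchange_mean; apply: eq_mean => z.
by under [RHS]eq_mean do rewrite inE /=; rewrite mean_cst ?sum_unif.
Qed.

Lemma mean_marginal_xy (S : X -> Y -> bool) :
  \E_(x ~ unif R A) \E_(y ~ unif R B)
    ((S x y)%:R * \E_(z ~ unif R C) (((x, y, z) \in E)%:R / k)) =
  #|E :&: (cyl_xy S :&: b)|%:R / #|b|%:R / k.
Proof.
rewrite setIA -mean_box -meanZr; apply: eq_mean => x.
rewrite -meanZr; apply: eq_mean => y.
rewrite -meanZ -meanZr; apply: eq_mean => z.
by rewrite !inE /= andbC -mulnb natrM mulrA.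
Qed.

Lemma mean_marginal_xz (S : X -> Z -> bool) :
  \E_(x ~ unif R A) \E_(z ~ unif R C)
    ((S x z)%:R * \E_(y ~ unif R B) (((x, y, z) \in E)%:R / k)) =
  #|E :&: (cyl_xz S :&: b)|%:R / #|b|%:R / k.
Proof.
rewrite setIA -mean_box -meanZr; apply: eq_mean => x.
rewrite exchange_mean -meanZr; apply: eq_mean => z.
rewrite -meanZ -meanZr; apply: eq_mean => y.
by rewrite !inE /= andbC -mulnb natrM mulrA.
Qed.

Lemma mean_marginal_yz (S : Y -> Z -> bool) :
  \E_(y ~ unif R B) \E_(z ~ unif R C)
    ((S y z)%:R * \E_(x ~ unif R A) (((x, y, z) \in E)%:R / k)) =
  #|E :&: (cyl_yz S :&: b)|%:R / #|b|%:R / k.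
Proof.
rewrite setIA -mean_box [in RHS]exchange_mean -meanZr; apply: eq_mean => y.
rewrite [in RHS]exchange_mean -meanZr; apply: eq_mean => z.
rewrite -meanZ -meanZr; apply: eq_mean => x.
by rewrite !inE /= andbC -mulnb natrM mulrA.
Qed.

End BoxMarginals.

End Box.

Arguments cyl_xy {X Y Z} S.
Arguments cyl_xz {X Y Z} S.
Arguments cyl_yz {X Y Z} S.

Lemma rect_volE (R : realFieldType) (X Z : finType) (u : X -> R) (w : Z -> R)
    (A : pred X) (B : pred Z) :
  rect_vol u w A B = \E_(x ~ u) \E_(z ~ w) (A x && B z)%:R.
Proof.
rewrite /rect_vol -meanZr; apply: eq_mean => x.
by rewrite -meanZ; apply: eq_mean => z; rewrite -mulnb natrM.
Qed.

(* [cyl] lifts sets of pairs to cylinders in [T], and [g] is a marginal of the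
   normalised indicator of [E] on [b]. *)
Lemma regular_of_max_potential (R : realFieldType) (T X Z : finType)
    (E b : {set T}) (cyl : (X -> Z -> bool) -> {set T})
    (u : X -> R) (w : Z -> R) (g : X -> Z -> R) e M :
  (forall x z, 0 <= g x z) -> 0 < density R E b ->
  (forall S : X -> Z -> bool,
    \E_(x ~ u) \E_(z ~ w) (S x z)%:R = #|cyl S :&: b|%:R / #|b|%:R) ->
  (forall S : X -> Z -> bool,
    \E_(x ~ u) \E_(z ~ w) ((S x z)%:R * g x z) =
    #|E :&: (cyl S :&: b)|%:R / #|b|%:R / density R E b) ->
  cyl (fun _ _ => true) = setT ->
  mass_bounded u w (2 ^+ e) (2 ^- (8 * e)) g ->
  (forall (A : pred X) (B : pred Z), let b' := cyl (fun x z => A x && B z) :&: b in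
    2 ^- (2 * e * M) * #|b|%:R <= #|b'|%:R :> R ->
    density R E b' ^+ M * #|b'|%:R <= density R E b ^+ M * #|b|%:R) ->
  regular e M u w g.
Proof.
move=> g_ge0 dens_gt0 vol_cyl mass_cyl cylT bounded b_max; split=> //.
  have := mass_cyl (fun _ _ => true); rewrite cylT setTI divff ?gt_eqF // => <-.
  by apply: eq_mean => x; apply: eq_mean => z; rewrite mul1r.
move=> A B; rewrite rect_volE (vol_cyl (fun x z => A x && B z)) mul1r => vol_ge.
have b_gt0 := density_gt0_card dens_gt0.
rewrite /rect_mass (mass_cyl (fun x z => A x && B z)).
by apply: subset_density_le => //; apply: b_max; rewrite -ler_pdivlMr.
Qed.

Section CubeBox.
Variables (R : realFieldType) (N : nat).
Implicit Types A B C : {set 'I_N}.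

Lemma slice_box_xy A B C (S : 'I_N -> 'I_N -> bool) :
  slice_function (fun p : cube N => p \in cyl_xy S :&: box A B C).
Proof.
apply: Or31; exists (fun x y => [&& S x y, x \in A & y \in B]), (fun z => z \in C).
by move=> x y z; rewrite !inE /= !andbA.
Qed.

Lemma slice_box_xz A B C (S : 'I_N -> 'I_N -> bool) :
  slice_function (fun p : cube N => p \in cyl_xz S :&: box A B C).
Proof.
apply: Or33; exists (fun x z => [&& S x z, x \in A & z \in C]), (fun y => y \in B).
by move=> x y z; rewrite !inE /= -!andbA [(y \in B) && _]andbC.
Qed.

Lemma slice_box_yz A B C (S : 'I_N -> 'I_N -> bool) :
  slice_function (fun p : cube N => p \in cyl_yz S :&: box A B C).
Proof.
apply: Or32; exists (fun x => x \in A), (fun y z => [&& S y z, y \in B & z \in C]).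
by move=> x y z; rewrite !inE /= -!andbA; do !bool_congr.
Qed.

Variables (d M : nat).
Hypotheses (d_gt0 : (0 < d)%N) (M_large : (400 * d <= M)%N).

Let d2_gt1 : (1 < 2 * d)%N. Proof. by lia. Qed.

Let M_ge_d2 : (200 * (2 * d) <= M)%N. Proof. by lia. Qed.

Let M_gt14 : (14 < M)%N. Proof. by lia. Qed.

Variables (E : {set cube N}) (rho : R).
Hypothesis rho_gt0 : 0 < rho.
Hypothesis slice_bound : forall S : {set cube N}, slice_function (fun p => p \in S) ->
  #|E :&: S|%:R <=
  2 ^+ d * rho * Num.max #|S|%:R (2 ^- (6 * d * M) * #|cube N|%:R).

Section MaximalBox.
Variables A B C : {set 'I_N}.
Let b := box A B C.
Hypothesis b_large : #|cube N|%:R <= (2 ^+ d) ^+ (2 * M) * #|b|%:R :> R.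
Hypothesis b_neq0 : b != set0.
Hypothesis b_dense : rho / 2 ^+ d <= density R E b.
Hypothesis b_max : forall A' B' C', let b' := box A' B' C' in
  2 ^- (6 * d * M) * #|cube N|%:R <= #|b'|%:R :> R ->
  density R E b' ^+ M * #|b'|%:R <= density R E b ^+ M * #|b|%:R.

Let A_neq0 : A != set0.
Proof. by apply: contraNneq b_neq0 => A0; rewrite -cards_eq0 card_box A0 cards0. Qed.

Let B_neq0 : B != set0.
Proof. by apply: contraNneq b_neq0 => B0; rewrite -cards_eq0 card_box B0 cards0 muln0. Qed.

Let C_neq0 : C != set0.
Proof. by apply: contraNneq b_neq0 => C0; rewrite -cards_eq0 card_box C0 cards0 muln0. Qed.

Let b_gt0 : 0 < #|b|%:R :> R.
Proof. by rewrite ltr0n card_gt0. Qed.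

Let dens_gt0 : 0 < density R E b.
Proof. by apply: lt_le_trans b_dense; rewrite divr_gt0 ?exprn_gt0. Qed.

Lemma cube_cutoff_le n :
  (n <= 4 * d * M)%N -> 2 ^- (6 * d * M) * #|cube N|%:R <= 2 ^- n * #|b|%:R :> R.
Proof.
move=> n_le; apply: (@le_trans _ _ (2 ^- (6 * d * M) * ((2 ^+ d) ^+ (2 * M) * #|b|%:R))).
  by rewrite ler_wpM2l // invr_ge0 exprn_ge0.
rewrite mulrA ler_pM2r // mulrC -exprM; apply: exp2_div_le.
by rewrite (_ : 6 * d * M = d * (2 * M) + 4 * d * M)%N ?leq_add2l //; ring.
Qed.

Lemma box_slice_mass_le (S : {set cube N}) :
  slice_function (fun p => p \in S :&: b) ->
  #|E :&: (S :&: b)|%:R / #|b|%:R / density R E b <=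
  2 ^+ (2 * d) * Num.max (#|S :&: b|%:R / #|b|%:R) (2 ^- (8 * (2 * d))).
Proof.
move=> /slice_bound mass_le; rewrite mulnC exprM.
apply: (slice_mass_le _ rho_gt0 b_gt0 b_dense mass_le); first exact: exprn_gt0.
apply: cube_cutoff_le; rewrite (_ : 8 * (d * 2) = 4 * d * 4)%N; last by ring.
by rewrite leq_mul // (leq_trans _ M_gt14).
Qed.

Let q x y z : R := ((x, y, z) \in E)%:R / density R E b.

Lemma box_bounded_xy :
  mass_bounded (unif R A) (unif R B) (2 ^+ (2 * d)) (2 ^- (8 * (2 * d)))
    (fun x y => \E_(z ~ unif R C) q x y z).
Proof.
move=> S; rewrite mean_marginal_xy (mean_cyl_xy R A B C_neq0).
exact/box_slice_mass_le/slice_box_xy.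
Qed.

Lemma box_regular_xz :
  regular (2 * d) M (unif R A) (unif R C) (fun x z => \E_(y ~ unif R B) q x y z).
Proof.
apply: (regular_of_max_potential (E := E) (b := b) (cyl := cyl_xz)) => //.
- by move=> x z; apply: mean_ge0 => y; rewrite ?unif_ge0 // divr_ge0 // density_ge0.
- by move=> S; exact: mean_cyl_xz.
- by move=> S; exact: mean_marginal_xz.
- move=> S; rewrite mean_marginal_xz (mean_cyl_xz R A C B_neq0).
  exact/box_slice_mass_le/slice_box_xz.
move=> A' C' /=.
rewrite (_ : _ :&: b = box (A :&: [set x | A' x]) B (C :&: [set z | C' z])) => [vol_ge|].
  by apply: b_max; apply: le_trans vol_ge; apply: cube_cutoff_le; rewrite mulnA.
apply/setP => -[[x y] z]; rewrite !inE /=.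
by case: (A' x); case: (C' z); rewrite ?andbT ?andbF.
Qed.

Lemma box_regular_yz :
  regular (2 * d) M (unif R B) (unif R C) (fun y z => \E_(x ~ unif R A) q x y z).
Proof.
apply: (regular_of_max_potential (E := E) (b := b) (cyl := cyl_yz)) => //.
- by move=> y z; apply: mean_ge0 => x; rewrite ?unif_ge0 // divr_ge0 // density_ge0.
- by move=> S; exact: mean_cyl_yz.
- by move=> S; exact: mean_marginal_yz.
- move=> S; rewrite mean_marginal_yz (mean_cyl_yz R B C A_neq0).
  exact/box_slice_mass_le/slice_box_yz.
move=> B' C' /=.
rewrite (_ : _ :&: b = box A (B :&: [set y | B' y]) (C :&: [set z | C' z])) => [vol_ge|].
  by apply: b_max; apply: le_trans vol_ge; apply: cube_cutoff_le; rewrite mulnA.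
apply/setP => -[[x y] z]; rewrite !inE /=.
by case: (B' y); case: (C' z); rewrite ?andbT ?andbF.
Qed.

Lemma box_cylinder_card_ge (F : cube N -> bool) :
  cylinder_intersection F -> E \subset [set p | F p] ->
  2 ^- (14 * d) * #|b|%:R <= #|[set p | F p] :&: b|%:R :> R.
Proof.
move=> [f [g [h FE]]] /subsetP E_sub.
rewrite -ler_pdivlMr // -mean_box (_ : 14 * d = 7 * (2 * d))%N; last by ring.
under eq_mean do under eq_mean do under eq_mean do rewrite inE FE.
have q_ge0 x y z : 0 <= q x y z by rewrite divr_ge0 // density_ge0.
have q_supp x y z : q x y z != 0 -> [&& f x y, g x z & h y z].
  rewrite mulf_eq0 negb_or pnatr_eq0 eqb0 negbK => /andP[/E_sub].
  by rewrite inE FE.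
exact: (regular_cylinder_density_ge d2_gt1 M_ge_d2
  (unif_ge0 R A) (sum_unif R A_neq0) (unif_ge0 R B) (sum_unif R B_neq0)
  (unif_ge0 R C) (sum_unif R C_neq0) (unif_atoms R A) (unif_atoms R B)
  q_ge0 q_supp box_regular_xz box_regular_yz box_bounded_xy).
Qed.

End MaximalBox.

Lemma cylinder_card_gt (F : cube N -> bool) :
  (0 < N)%N -> cylinder_intersection F -> E \subset [set p | F p] ->
  rho / 2 ^+ d <= density R E setT ->
  2 ^- (3 * d * M) * #|cube N|%:R < #|[set p | F p]|%:R :> R.
Proof.
move=> N_gt0 F_cyl E_sub dense.
have V_gt0 : (0 < #|cube N|)%N by rewrite !card_prod !card_ord !muln_gt0 N_gt0.
have V_gt0' : 0 < #|cube N|%:R :> R by rewrite ltr0n.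
have pow_gt0 n : 0 < 2 ^+ n :> R by exact: exprn_gt0.
pose boxes (i : {set 'I_N} * {set 'I_N} * {set 'I_N}) := box i.1.1 i.1.2 i.2.
have boxes_setT : boxes (setT, setT, setT) = setT by apply/setP => p; rewrite !inE.
have boxes_dens_le i : 2 ^- (6 * d * M) * #|cube N|%:R <= #|boxes i|%:R :> R ->
    density R E (boxes i) <= 2 ^+ d * rho.
  move=> large; have i_gt0 : 0 < #|boxes i|%:R :> R.
    by apply: lt_le_trans large; rewrite mulr_gt0 // invr_gt0.
  rewrite ler_pdivrMr //.
  have := slice_bound (slice_box_xy i.1.1 i.1.2 i.2 (fun _ _ => true)).
  by rewrite (_ : cyl_xy _ = setT) ?setTI ?max_l.
have eta_le1 : 2 ^- (6 * d * M) <= 1 :> R.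
  by rewrite invf_le1 // exprn_ege1 //; lra.
have M_gt0 : (0 < M)%N by exact: leq_trans M_gt14.
have [[[A B] C] [large i_dense i_max]] := exists_max_potential M_gt0 V_gt0 boxes_setT
  (pow_gt0 d) rho_gt0 eta_le1 dense boxes_dens_le.
have b_neq0 : boxes (A, B, C) != set0.
  apply: contraTneq i_dense => ->; rewrite /density cards0 invr0 mulr0 -ltNge.
  by rewrite divr_gt0.
have := box_cylinder_card_ge large b_neq0 i_dense
  (fun A' B' C' => i_max (A', B', C')) F_cyl E_sub.
set b := box A B C => F_ge.
apply: (@lt_le_trans _ _ (2 ^- (14 * d) * #|b|%:R)); last first.
  by apply: (le_trans F_ge); rewrite ler_nat subset_leq_card // subsetIl.
apply: (le_lt_trans (ler_wpM2l _ large)); first by rewrite invr_ge0 exprn_ge0.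
have b_gt0 : 0 < #|b|%:R :> R by rewrite ltr0n card_gt0.
rewrite mulrA ltr_pM2r // mulrC -exprM ltr_pdivrMr // mulrC ltr_pdivlMr //.
rewrite -exprD ltr_eXn2l; last by lra.
rewrite (_ : 3 * d * M = d * (2 * M) + d * M)%N ?ltn_add2l; last by ring.
by rewrite mulnC ltn_pmul2l.
Qed.

End CubeBox.

(** * Evasive sets *)

Section Expect.
Variables (R : realType) (T : finType).
Implicit Types (D : {set T}) (s : T -> bool).

Lemma eq_expect D s s' : s =1 s' -> expect R D s = expect R D s'.
Proof. by move=> ss; rewrite /expect; under eq_bigr do rewrite ss. Qed.

Lemma expectE D s : expect R D s = density R [set w | s w] D.
Proof.
rewrite /expect /density -natr_sum -big_mkcondr sum1_card /=.
by congr (_%:R / _); apply: eq_card => w; rewrite !inE andbC.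
Qed.

Lemma expect_setTE s : expect R setT s = #|[set w | s w]|%:R / #|T|%:R.
Proof. by rewrite expectE /density setIT cardsT. Qed.

Lemma expect_ge0 D s : 0 <= expect R D s.
Proof. by rewrite expectE density_ge0. Qed.

Lemma expect_le D s s' : (forall w, s w -> s' w) -> expect R D s <= expect R D s'.
Proof.
move=> ss; rewrite !expectE ler_wpM2r ?invr_ge0 // ler_nat subset_leq_card //.
by apply/setSI/subsetP => w; rewrite !inE; exact: ss.
Qed.

Lemma expect_le1 D s : expect R D s <= 1.
Proof.
rewrite expectE /density; have [->|D_gt0] := posnP #|D|; first by rewrite invr0 mulr0.
by rewrite ler_pdivrMr ?ltr0n // mul1r ler_nat subset_leq_card // subsetIr.
Qed.

End Expect.

Lemma exists_superset_card (R : realFieldType) (A : finType) (P : {set A}) (s r : R) :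
  P != set0 -> 0 <= s -> r <= #|A|%:R * s ->
  exists P' : {set A}, [/\ P \subset P', r <= #|P'|%:R * s &
    #|P'|%:R * s <= Num.max (#|P|%:R * s) (2 * r)].
Proof.
move=> P_neq0 s_ge0 r_le; have [r_leP|r_gtP] := leP r (#|P|%:R * s).
  by exists P; rewrite le_max lexx.
pose large (Q : {set A}) := (P \subset Q) && (r <= #|Q|%:R * s).
have [|P' /minsetP[/andP[sub_P P'_large] P'_min] _] := @minset_exists _ large setT.
  by rewrite /large subsetT cardsT.
exists P'; split=> //; rewrite le_max; apply/orP; right.
have /subsetPn[a aP' aNP] : ~~ (P' \subset P).
  apply: contraTN P'_large => sub_P'; rewrite -ltNge (le_lt_trans _ r_gtP) //.
  by rewrite ler_wpM2r // ler_nat subset_leq_card.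
have sub_Pa : P \subset P' :\ a by rewrite subsetD1 sub_P.
have small : #|P' :\ a|%:R * s < r.
  rewrite ltNge; apply/negP => a_large.
  have /setP/(_ a) : P' :\ a = P' by apply: P'_min; rewrite ?subD1set // /large sub_Pa.
  by rewrite !inE eqxx aP'.
apply: (@le_trans _ _ (2 * (#|P' :\ a|%:R * s))); last by rewrite ler_pM2l // ltW.
rewrite mulrA ler_wpM2r // -natrM ler_nat (cardsD1 a P') aP' mul2n -addnn leq_add2r.
by apply: leq_trans (subset_leq_card sub_Pa); rewrite card_gt0.
Qed.

Lemma exists_superrectangle_card (R : realFieldType) (A B : finType)
    (P : {set A}) (Q : {set B}) (r : R) :
  P != set0 -> Q != set0 -> r <= #|A|%:R * #|B|%:R ->
  exists (P' : {set A}) (Q' : {set B}),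
    [/\ P \subset P', Q \subset Q', r <= #|P'|%:R * #|Q'|%:R &
        #|P'|%:R * #|Q'|%:R <= Num.max (#|P|%:R * #|Q|%:R) (2 * r)].
Proof.
move=> P_neq0 Q_neq0 r_le; have [r_leQ|r_gtQ] := leP r (#|A|%:R * #|Q|%:R).
  have [P' [sub_P large small]] := exists_superset_card P_neq0 (ler0n R _) r_leQ.
  by exists P', Q; split.
rewrite mulrC in r_le.
have [Q' [sub_Q large small]] := exists_superset_card Q_neq0 (ler0n R #|A|) r_le.
exists setT, Q'; rewrite cardsT [_ * #|Q'|%:R]mulrC subsetT; split=> //.
apply: (le_trans small); rewrite ge_max !le_max lexx orbT andbT.
have : 0 <= #|A|%:R * #|Q|%:R :> R by rewrite mulr_ge0.
by rewrite [#|Q|%:R * _]mulrC => ?; apply/orP; right; lra.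
Qed.

Definition rectangle (T A B : finType) (e : T -> A * B) (P : {set A}) (Q : {set B})
    (w : T) : bool :=
  ((e w).1 \in P) && ((e w).2 \in Q).

Lemma expect_rectangle (R : realType) (T A B : finType) (e : T -> A * B) P Q :
  bijective e -> expect R setT (rectangle e P Q) = #|P|%:R * #|Q|%:R / #|T|%:R.
Proof.
move=> e_bij; rewrite expect_setTE -natrM -cardsX; congr (_%:R / _).
rewrite -(on_card_preimset (f := e)); last by apply: onW_bij.
by apply: eq_card => w; rewrite !inE.
Qed.

Lemma slice_rectangle (N : nat) (s : cube N -> bool) :
  slice_function s ->
  exists (A B : finType) (e : cube N -> A * B) (P : {set A}) (Q : {set B}),
    [/\ bijective e, s =1 rectangle e P Q &
        forall P' Q', slice_function (rectangle e P' Q')].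
Proof.
case=> -[g [h s_gh]].
- exists ('I_N * 'I_N)%type, 'I_N, id, [set p | g p.1 p.2], [set z | h z].
  split=> [|[[x y] z]|P Q]; [by exists id | by rewrite s_gh /rectangle !inE |].
  by apply: Or31; exists (fun x y => (x, y) \in P), (fun z => z \in Q).
- exists 'I_N, ('I_N * 'I_N)%type, (fun w => (w.1.1, (w.1.2, w.2))).
  exists [set x | g x], [set p | h p.1 p.2].
  split=> [|[[x y] z]|P Q]; last 2 first.
  + by rewrite s_gh /rectangle !inE.
  + by apply: Or32; exists (fun x => x \in P), (fun y z => (y, z) \in Q).
  by exists (fun w => (w.1, w.2.1, w.2.2)) => [[[x y] z]|[x [y z]]].
exists ('I_N * 'I_N)%type, 'I_N, (fun w => ((w.1.1, w.2), w.1.2)).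
exists [set p | g p.1 p.2], [set y | h y].
split=> [|[[x y] z]|P Q]; last 2 first.
- by rewrite s_gh /rectangle !inE.
- by apply: Or33; exists (fun x z => (x, z) \in P), (fun y => y \in Q).
by exists (fun w => (w.1.1, w.2, w.1.2)) => [[[x y] z]|[[x y] z]].
Qed.

Section Evasive.
Variables (R : realType) (N : nat).
Hypothesis N_gt0 : (0 < N)%N.
Implicit Types (D : {set cube N}) (F s : cube N -> bool).

Lemma card_cube_gt0 : (0 < #|cube N|)%N.
Proof. by rewrite !card_prod !card_ord !muln_gt0 N_gt0. Qed.

(* Slices below the density threshold are enlarged until they reach it. *)
Lemma evasive_slice_le D (k d : R) s :
  0 <= d -> evasive k d D -> slice_function s ->
  expect R D s <= 2 `^ k * Num.max (expect R setT s) (2 * 2 `^ (- d)).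
Proof.
move=> d_ge0 ev /slice_rectangle[A [B [e [P [Q [e_bij s_rect rect_slice]]]]]].
have V_gt0 : 0 < #|cube N|%:R :> R by rewrite ltr0n card_cube_gt0.
rewrite !(eq_expect _ _ s_rect) expect_rectangle //.
have [PQ0|] := boolP ((P == set0) || (Q == set0)).
  rewrite [leLHS](_ : _ = 0); last first.
    rewrite /expect big1 ?mul0r // => w _.
    by rewrite /rectangle; case/orP: PQ0 => /eqP ->; rewrite inE ?andbF.
  by rewrite mulr_ge0 ?powR_ge0 // le_max divr_ge0 // mulr_ge0.
rewrite negb_or => /andP[P_neq0 Q_neq0].
have [|P' [Q' [sub_P sub_Q large small]]] :=
    @exists_superrectangle_card R A B P Q (2 `^ (- d) * #|cube N|%:R) P_neq0 Q_neq0.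
  rewrite -natrM -card_prod -(bij_eq_card e_bij) ler_piMl // ?(ltW V_gt0) //.
  by rewrite -[leRHS](powRr0 2) ler_powR ?oppr_le0 // ler1n.
apply: (@le_trans _ _ (expect R D (rectangle e P' Q'))).
  by apply: expect_le => w /andP[/(subsetP sub_P) wP /(subsetP sub_Q) wQ]; apply/andP.
apply: (le_trans (ev _ (rect_slice P' Q') _)).
  by rewrite expect_rectangle // ler_pdivlMr.
rewrite ler_wpM2l ?powR_ge0 // expect_rectangle // ler_pdivrMr // maxr_pMl ?(ltW V_gt0) //.
by rewrite divfK ?gt_eqF // -mulrA.
Qed.

Lemma cylinder_expect_lt D F (n M : nat) :
  (0 < n)%N -> (400 * n <= M)%N -> D != set0 -> cylinder_intersection F ->
  (forall s, slice_function s ->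
    expect R D s <= 2 ^+ n * Num.max (expect R setT s) (2 ^- (6 * n * M))) ->
  expect R setT F <= 2 ^- (3 * n * M) -> expect R D F < 2 ^- n.
Proof.
move=> n_gt0 M_large D_neq0 F_cyl slice_le F_le; rewrite ltNge; apply/negP => F_ge.
have V_gt0 : 0 < #|cube N|%:R :> R by rewrite ltr0n card_cube_gt0.
have D_gt0 : 0 < #|D|%:R :> R by rewrite ltr0n card_gt0.
pose E := D :&: [set w | F w].
have slice_bound (S : {set cube N}) : slice_function (fun w => w \in S) ->
    #|E :&: S|%:R <= 2 ^+ n * (#|D|%:R / #|cube N|%:R) *
      Num.max #|S|%:R (2 ^- (6 * n * M) * #|cube N|%:R) :> R.
  move=> /slice_le; rewrite expect_setTE expectE (_ : [set w in S] = S); last first.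
    by apply/setP => w; rewrite inE.
  rewrite ler_pdivrMr // => mass_le.
  have -> : Num.max #|S|%:R (2 ^- (6 * n * M) * #|cube N|%:R) =
      Num.max (#|S|%:R / #|cube N|%:R) (2 ^- (6 * n * M)) * #|cube N|%:R :> R.
    by rewrite maxr_pMl ?(ltW V_gt0) // divfK ?gt_eqF.
  rewrite [leRHS](_ : _ =
      2 ^+ n * Num.max (#|S|%:R / #|cube N|%:R) (2 ^- (6 * n * M)) * #|D|%:R).
    apply: le_trans mass_le; rewrite ler_nat subset_leq_card //.
    by rewrite setIC setIS // subsetIl.
  by field; rewrite gt_eqF.
have dense : #|D|%:R / #|cube N|%:R / 2 ^+ n <= density R E setT.
  rewrite /density setIT cardsT mulrAC ler_wpM2r ?invr_ge0 //.
  move: F_ge; rewrite expectE /density ler_pdivlMr // mulrC setIC.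
  by [].
have := cylinder_card_gt n_gt0 M_large (divr_gt0 D_gt0 V_gt0) slice_bound N_gt0 F_cyl
  (subsetIr _ _) dense.
by rewrite -ltr_pdivlMr // -expect_setTE ltNge F_le.
Qed.

Lemma exists_slice_of_cylinder F :
  cylinder_intersection F ->
  exists s, [/\ slice_function s, forall w, F w -> s w &
    expect R setT s <= (2 + expect R setT F) / 3].
Proof.
move=> [f [g [h FE]]].
pose sf (w : cube N) := f w.1.1 w.1.2.
pose sg (w : cube N) := g w.1.1 w.2.
pose sh (w : cube N) := h w.1.2 w.2.
have sum_le : expect R setT sf + expect R setT sg + expect R setT sh <= 2 + expect R setT F.
  have V_gt0 : 0 < #|[set: cube N]|%:R :> R by rewrite cardsT ltr0n card_cube_gt0.
  have -> : 2 = (\sum_(w in [set: cube N]) 2) / #|[set: cube N]|%:R :> R.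
    by rewrite sumr_const -[X in X / _]mulr_natr mulfK // gt_eqF.
  rewrite /expect -!mulrDl ler_pM2r ?invr_gt0 // -!big_split ler_sum // => -[[x y] z] _ /=.
  by rewrite FE /sf /sg /sh; case: (f x y); case: (g x z); case: (h y z) => /=; lra.
have [f_le|f_gt] := leP (expect R setT sf) ((2 + expect R setT F) / 3).
  exists sf; split=> // [|[[x y] z]]; last by rewrite FE => /and3P[].
  by apply: Or31; exists f, (fun=> true) => x y z; rewrite andbT.
have [g_le|g_gt] := leP (expect R setT sg) ((2 + expect R setT F) / 3).
  exists sg; split=> // [|[[x y] z]]; last by rewrite FE => /and3P[].
  by apply: Or33; exists g, (fun=> true) => x y z; rewrite andbT.
exists sh; split=> [|[[x y] z]|]; first by apply: Or32; exists (fun=> true), h.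
  by rewrite FE => /and3P[].
by lra.
Qed.

Lemma powR2_sqr_le (x : R) : 8 * x <= 1 -> (2 `^ x) ^+ 2 <= 6 / 5.
Proof.
move=> x_le; rewrite -(@ler_pXn2r _ 4) ?nnegrE ?exprn_ge0 ?powR_ge0 //; last by lra.
apply: (@le_trans _ _ 2); last by lra.
rewrite -exprM -powR_mulrn ?powR_ge0 // -powRrM -[leRHS]powRr1 // ler_powR ?ler1n //.
by lra.
Qed.

Lemma evasive_expect_le_of_half D F (k d : R) :
  8 * k <= 1 -> 2 <= d -> evasive k d D -> cylinder_intersection F ->
  expect R setT F <= 1 / 2 -> expect R D F <= 2 `^ (- k).
Proof.
move=> k_small d_large ev F_cyl F_le.
have [s [s_slice F_s s_le]] := exists_slice_of_cylinder F_cyl.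
have d_ge0 : 0 <= d by lra.
have cutoff_le : 2 * 2 `^ (- d) <= 1 / 2 :> R.
  apply: (@le_trans _ _ (2 * 2 `^ (- 2%:R))); last by rewrite powRN powR_mulrn //; lra.
  by rewrite ler_pM2l // ler_powR ?ler1n // lerN2.
apply: (le_trans (expect_le R D F_s)).
apply: (le_trans (evasive_slice_le d_ge0 ev s_slice)).
apply: (@le_trans _ _ (2 `^ k * (5 / 6))).
  by rewrite ler_wpM2l ?powR_ge0 // ge_max; apply/andP; split; lra.
rewrite powRN -[leRHS]div1r ler_pdivlMr ?powR_gt0 // mulrAC -expr2.
by have := powR2_sqr_le k_small; lra.
Qed.

Lemma evasive_expect_le_of_exp D F (k d : R) (n M : nat) :
  (0 < n)%N -> (400 * n <= M)%N -> D != set0 -> k <= n%:R -> (6 * n * M).+1%:R <= d ->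
  evasive k d D -> cylinder_intersection F -> expect R setT F <= 2 ^- (3 * n * M) ->
  expect R D F <= 2 `^ (- k).
Proof.
move=> n_gt0 M_large D_neq0 k_le d_ge ev F_cyl F_le.
have powR2N m : 2 `^ (- m%:R) = 2 ^- m :> R by rewrite powRN powR_mulrn.
have two_ge1 : 1 <= 2 :> R by rewrite ler1n.
apply: (@le_trans _ _ (2 ^- n)); last by rewrite -powR2N ler_powR // lerN2.
apply/ltW/(cylinder_expect_lt n_gt0 M_large) => // s s_slice.
have d_ge0 : 0 <= d by exact: le_trans d_ge.
apply: (le_trans (evasive_slice_le d_ge0 ev s_slice)); apply: ler_pM.
- exact: powR_ge0.
- by rewrite le_max expect_ge0.
- by rewrite -powR_mulrn // ler_powR.
rewrite ge_max le_max lexx /= le_max; apply/orP; right.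
apply: (@le_trans _ _ (2 * 2 ^- (6 * n * M).+1)).
  by rewrite ler_pM2l // -powR2N ler_powR // lerN2.
by rewrite exprS invfM mulVKf ?pnatr_eq0.
Qed.

End Evasive.

Theorem theorem5p1 (R : realType) :
  exists2 c : R, 0 < c &
  exists2 C : R, 0 < C &
  forall (t N : nat) (D : {set cube N}),
    (1 <= N)%N -> D != set0 ->
    evasive (c * Num.sqrt t%:R) (t%:R / c) D ->
    forall F : cube N -> bool, cylinder_intersection F ->
      expect R [set: cube N] F <= 2 `^ (- t%:R) ->
      expect R D F <= 2 `^ (- (C * Num.sqrt t%:R)).
Proof.
have c_gt0 : 0 < 1 / 400 :> R by lra.
exists (1 / 400) => //; exists (1 / 400) => // t N D N_gt0 D_neq0 ev F F_cyl F_le.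
have [t0|t_gt0] := posnP t; first by rewrite t0 sqrtr0 mulr0 oppr0 powRr0 expect_le1.
set s := Num.sqrt t%:R in ev *.
have s_ge0 : 0 <= s by exact: sqrtr_ge0.
have s_sqr : s ^+ 2 = t%:R by rewrite sqr_sqrtr.
have t_ge1 : 1 <= t%:R :> R by rewrite ler1n.
have d_ge : 400 * t%:R <= t%:R / (1 / 400) :> R by lra.
have [s_small|s_large] := leP s 40.
  apply: (evasive_expect_le_of_half N_gt0 _ _ ev F_cyl); [lra | lra |].
  apply: (le_trans F_le); rewrite -[leRHS](_ : 2 `^ (- 1) = _).
    by rewrite ler_powR ?ler1n // lerN2.
  by rewrite powRN powRr1 ?div1r.
pose n := (Num.truncn (1 / 400 * s)).+1.
have n_gt : 1 / 400 * s < n%:R by exact: truncnS_gt.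
have n_le : n%:R <= 1 / 400 * s + 1.
  by rewrite -[n%:R]natr1 lerD2r truncn_le; lra.
apply: (evasive_expect_le_of_exp N_gt0 _ (leqnn (400 * n))
  D_neq0 (ltW n_gt) _ ev F_cyl) => //.
  by rewrite -[(_.+1)%:R]natr1 !natrM; apply: le_trans d_ge; rewrite -s_sqr; nra.
apply: (le_trans F_le); rewrite powRN powR_mulrn // lef_pV2 ?posrE ?exprn_gt0 //.
by rewrite ler_weXn2l ?ler1n // -(ler_nat R) !natrM -s_sqr; nra.
Qed.
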